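(* In the standing setup, assume $T_1,T_2,D_1,D_2$ are AF-domains with $\dim T_1=\operatorname{ht} M_1$ and $\dim T_2=\operatorname{ht} M_2$. Then $$\dim(R_1\otimes_k R_2)=\max\Big\{\operatorname{ht} M_1[\operatorname{t.d.}(R_2)]+\mathrm{D}\big(\operatorname{t.d.}(D_1),\dim D_1,R_2\big),\ \operatorname{ht} M_2[\operatorname{t.d.}(R_1)]+\mathrm{D}\big(\operatorname{t.d.}(D_2),\dim D_2,R_1\big)\Big\}.$$
   Context: Standing setup: $k$ is a field, all rings are commutative $k$-algebras of finite transcendence degree over $k$. For $i=1,2$: $T_i$ is an integral domain with a maximal ideal $M_i$, $K_i=T_i/M_i$, $\varphi_i:T_i\to K_i$ is the canonical surjection, $D_i$ is a proper $k$-subalgebra of $K_i$, and $R_i=\varphi_i^{-1}(D_i)$. $\operatorname{t.d.}$ denotes transcendence degree over $k$, $\dim$ Krull dimension. For an ideal $I$ of $A$, $I[n]=I[X_1,\dots,X_n]\subseteq A[X_1,\dots,X_n]$; $M_i$ is regarded as a prime ideal of $R_i$ and $M_1[n]$ is taken in $R_1[n]$. For a $k$-algebra $A$ of finite transcendence degree and integers $0\le d\le s$, $\mathrm{D}(s,d,A)=\max\{\operatorname{ht} p[s]+\min(s,\,d+\operatorname{t.d.}(A/p)) : p\in\operatorname{Spec}(A)\}$. An integral domain $A$ (a $k$-algebra of finite transcendence degree) is an AF-domain if $\operatorname{ht} p+\operatorname{t.d.}(A/p)=\operatorname{t.d.}(A)$ for all prime ideals $p$ of $A$. *)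

(* Defs.v *)
From HB Require Import structures.
From mathcomp Require Import all_boot all_order all_algebra.
From mathcomp Require Import mpoly.
From Stdlib Require Import ClassicalEpsilon.

Set Implicit Arguments.
Unset Strict Implicit.
Unset Printing Implicit Defensive.

Import GRing.Theory.
Local Open Scope ring_scope.

Definition natsup (P : nat -> Prop) : nat :=
  epsilon (inhabits 0%N) (fun m => P m /\ forall n, P n -> (n <= m)%N).

Definition is_ideal (A : comNzRingType) (I : A -> Prop) : Prop :=
  I 0 /\ (forall x y, I x -> I y -> I (x + y)) /\ (forall a x, I x -> I (a * x)).

Definition is_prime (A : comNzRingType) (P : A -> Prop) : Prop :=
  is_ideal P /\ ~ P 1 /\ (forall x y, P (x * y) -> P x \/ P y).

Definition is_maximal (A : comNzRingType) (M : A -> Prop) : Prop :=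
  is_ideal M /\ ~ M 1 /\
  (forall J : A -> Prop, is_ideal J -> (forall x, M x -> J x) ->
     (forall x, J x -> M x) \/ J 1).

Definition prime_chain (A : comNzRingType) (c : nat -> A -> Prop) (n : nat) :=
  (forall i, (i <= n)%N -> is_prime (c i)) /\
  (forall i, (i < n)%N ->
     (forall x, c i x -> c i.+1 x) /\ (exists x, c i.+1 x /\ ~ c i x)).

Definition kdim (A : comNzRingType) : nat :=
  natsup (fun n => exists c : nat -> A -> Prop, prime_chain c n).

Definition height (A : comNzRingType) (P : A -> Prop) : nat :=
  natsup (fun n => exists c : nat -> A -> Prop,
            prime_chain c n /\ forall x, c n x <-> P x).

Definition ext_ideal (A : comNzRingType) (s : nat) (I : A -> Prop)
  : {mpoly A[s]} -> Prop :=
  fun f => forall m, I (f@_m).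
Arguments ext_ideal {A} s I _.

Definition alg_indep_mod (k : fieldType) (A : comAlgType k) (P : A -> Prop)
  (n : nat) (x : 'I_n -> A) : Prop :=
  forall f : {mpoly k[n]}, f != 0 -> ~ P (mmap (in_alg A) x f).

Definition td_mod (k : fieldType) (A : comAlgType k) (P : A -> Prop) : nat :=
  natsup (fun n => exists x : 'I_n -> A, alg_indep_mod P x).

Definition td (k : fieldType) (A : comAlgType k) : nat :=
  td_mod (fun a : A => a = 0).

Definition finite_td (k : fieldType) (A : comAlgType k) : Prop :=
  exists b, forall n (x : 'I_n -> A), alg_indep_mod (fun a : A => a = 0) x ->
    (n <= b)%N.

Definition is_domain (A : comNzRingType) : Prop :=
  forall x y : A, x * y = 0 -> x = 0 \/ y = 0.

Definition is_field (A : comNzRingType) : Prop :=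
  forall x : A, x != 0 -> exists y, x * y = 1.

Definition AF_domain (k : fieldType) (A : comAlgType k) : Prop :=
  is_domain A /\ finite_td A /\
  forall P : A -> Prop, is_prime P -> (height P + td_mod P)%N = td A.

Definition Dfun (k : fieldType) (s d : nat) (A : comAlgType k) : nat :=
  natsup (fun v => exists P : A -> Prop, is_prime P /\
            v = (height (ext_ideal s P) + minn s (d + td_mod P))%N).

Definition kalg_hom (k : fieldType) (A B : comAlgType k) (f : A -> B) : Prop :=
  (forall x y, f (x + y) = f x + f y) /\ (forall x y, f (x * y) = f x * f y) /\
  f 1 = 1 /\ (forall (c : k) x, f (c *: x) = c *: f x).

(* (C, i1, i2) is a tensor product A ⊗_k B of commutative k-algebras, given by
   its universal property (coproduct of commutative k-algebras). *)
Definition is_tensor (k : fieldType) (A B C : comAlgType k)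
  (i1 : A -> C) (i2 : B -> C) : Prop :=
  kalg_hom i1 /\ kalg_hom i2 /\
  forall (E : comAlgType k) (f1 : A -> E) (f2 : B -> E),
    kalg_hom f1 -> kalg_hom f2 ->
    exists h : C -> E, kalg_hom h /\ (forall a, h (i1 a) = f1 a) /\
      (forall b, h (i2 b) = f2 b) /\
      forall h' : C -> E, kalg_hom h' -> (forall a, h' (i1 a) = f1 a) ->
        (forall b, h' (i2 b) = f2 b) -> forall c, h' c = h c.

(* T integral domain, M maximal ideal, phi : T -> K a surjective k-algebra map
   with kernel M (so K ≅ T/M and phi is the canonical surjection), D a proper
   k-subalgebra of K (given by an injective k-algebra map iD : D -> K whose
   image is not all of K), and R = phi^{-1}(D) (given by an injective k-algebra
   map iR : R -> T whose image is exactly phi^{-1}(image iD)). *)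
Definition pullback_setup (k : fieldType) (T K D R : comAlgType k)
  (M : T -> Prop) (phi : T -> K) (iD : D -> K) (iR : R -> T) : Prop :=
  is_domain T /\ is_maximal M /\
  kalg_hom phi /\ (forall y : K, exists t, phi t = y) /\
  (forall t, phi t = 0 <-> M t) /\
  kalg_hom iD /\ injective iD /\ (exists y : K, forall d, iD d <> y) /\
  kalg_hom iR /\ injective iR /\
  (forall t : T, (exists r, iR r = t) <-> (exists d, iD d = phi t)).

Definition ideal_in (R T : comNzRingType) (iR : R -> T) (M : T -> Prop) : R -> Prop :=
  fun r => M (iR r).

(* Main.v *)
From HB Require Import structures.
Require Import Defs.
From mathcomp Require Import all_boot all_order all_algebra.
From mathcomp Require Import mpoly.
From mathcomp Require Import ring_quotient fraction boolp.
From mathcomp Require classical_sets.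
From mathcomp Require Import zify ring.
From Stdlib Require Import ClassicalEpsilon.

Set Implicit Arguments.
Unset Strict Implicit.
Unset Printing Implicit Defensive.

Import GRing.Theory.

(* For i = 1, 2 put t = t.d. R, h = ht M, s = t.d. D, d = dim D and e = t - h - s.

   Upper bound. Along a strict chain of primes P of R1 (x) R2 the transcendence
   degree of the residue ring drops at every step, and it lies between the
   maximum and the sum of those of the residue rings of the two contractions.
   A prime of R_i not containing M_i comes from a prime of the AF-domain T_i and
   one containing M_i from a prime of the AF-domain D_i, so these degrees are
   known. Following the chain up to the points where its contractions reach M_1
   and M_2 bounds its length by the maximum of
     h1 + min(t2, e1) + h2 + min(s1, e2) + min(s1 + d2, d1 + s2)
   and of its mirror image. Both are at most the right-hand side: R[X_1..X_n]
   has a chain of length h + min(n, e) up to M[n], made of the kernels of the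
   specializations of variables to elements of T independent over D.

   Lower bound. Let P be a prime of A (x) B over q in Spec B, and let y_1..y_m in
   B be independent mod q. Since (A (x) B/q), localized at k[y], is flat over
   A[z_1..z_m], chains of primes of A[z_1..z_m] below the preimage of P lift to
   chains of primes of A (x) B below P and over q. Apply this with A = R1 over
   q in Spec R2 (length min(s1, d1 + t.d.(R2/q))), with A = R2 over M1 (length
   ht q[s1]) and with A = R1 over 0 (length ht M1[t2]), and glue. *)


(** * Residue fields *)

(** The hypotheses on T and D fix the bookkeeping: in an AF-domain the height of a prime and the
    transcendence degree of its residue ring determine each other, and dim T = ht M bounds by h the
    loss of transcendence degree at a prime of R not containing M. The two terms of the maximum
    correspond to the order in which a chain reaches M_1 and M_2, and min(s1 + d2, d1 + s2) is the
    dimension of D1 (x) D2, which is what remains above both. The two bounds in min(n, e) arise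
    because each specialization uses up a variable and an element of T/M transcendental over D.

    The tensor product is known only through its universal property, which tests algebra maps, while
    going down needs additive maps out of it; these come from applying the property to an algebra of
    formal sums. Flatness is used in the form of dual functionals: over the fractions of k[y] the
    ring B/q is a vector space, and functionals with values in a residue field of A[z] detect its
    elements. Every maximum is a chosen value that means something only once a bound is known, and
    finite transcendence degree supplies the bounds. *)

Section ResidueField.
Local Open Scope ring_scope.
Local Open Scope quotient_scope.
Variables (A : comNzRingType) (P : A -> Prop).

(* The unused argument lets instance resolution recover the primality proof. *)
Definition prime_pred_of (hP : is_prime P) : A -> bool := fun x => `[< P x >].

Variable hP : is_prime P.
Local Notation prime_pred := (prime_pred_of hP).

Fact prime_pred_closed : idealr_closed prime_pred.
Proof.
have [[I0 [ID IM]] [N1 _]] := hP; split; first exact/asboolP.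
  by apply/negP => /asboolP.
move=> a x y /asboolP Px /asboolP Py; apply/asboolP.
by apply: ID => //; apply: IM.
Qed.

HB.instance Definition _ := isIdealr.Build A prime_pred prime_pred_closed.

Definition prime_idealr : idealr A := prime_pred.
Definition prime_quot := {ideal_quot prime_idealr}.

HB.instance Definition _ := GRing.ComNzRing.on prime_quot.

Definition prime_quot_pi : {rmorphism A -> prime_quot} := \pi_prime_quot.

Fact prime_quot_pi0 a : prime_quot_pi a = 0 <-> P a.
Proof.
have -> : (0 : prime_quot) = prime_quot_pi 0 by rewrite rmorph0.
split=> [/eqP|h]; last apply/eqP; rewrite -Quotient.idealrBE subr0.
  by move/asboolP.
exact/asboolP.
Qed.

Fact prime_quot_pi_surj (x : prime_quot) : exists a, prime_quot_pi a = x.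
Proof. by exists (repr x); rewrite /prime_quot_pi /= reprK. Qed.

Fact prime_quot_integral (x y : prime_quot) : x * y = 0 -> (x == 0) || (y == 0).
Proof.
have [a <-] := prime_quot_pi_surj x; have [b <-] := prime_quot_pi_surj y.
rewrite -rmorphM => /prime_quot_pi0; have [_ [_ hM]] := hP; move=> /hM.
by case=> /prime_quot_pi0 ->; rewrite eqxx ?orbT.
Qed.

(** [{fraction _}] takes an [idomainType], so the quotient needs a unit predicate and an inverse;
    both are chosen classically, the inverse being the identity on nonunits. *)
Definition prime_quot_unit (x : prime_quot) : bool := `[< exists y, y * x = 1 >].
Definition prime_quot_inv (x : prime_quot) : prime_quot :=
  if pselect (exists y, y * x = 1) is left h then projT1 (cid h) else x.

Fact prime_quot_mulVr : {in prime_quot_unit, left_inverse 1 prime_quot_inv *%R}.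
Proof.
move=> x /asboolP h; rewrite /prime_quot_inv; case: pselect => // h'.
by case: cid.
Qed.

Fact prime_quot_unitP x y : y * x = 1 -> prime_quot_unit x.
Proof. by move=> h; apply/asboolP; exists y. Qed.

Fact prime_quot_inv0id : {in [predC prime_quot_unit], prime_quot_inv =1 id}.
Proof.
move=> x /negP nh; rewrite /prime_quot_inv; case: pselect => // h.
by case: nh; apply/asboolP.
Qed.

HB.instance Definition _ := GRing.ComNzRing_hasMulInverse.Build prime_quot
  prime_quot_mulVr prime_quot_unitP prime_quot_inv0id.
HB.instance Definition _ :=
  GRing.ComUnitRing_isIntegral.Build prime_quot prime_quot_integral.

(** Primes are used below as kernels of maps to fields, so that algebraic dependence modulo a prime
    becomes dependence in a field. *)
Lemma residue_field : exists (F : fieldType) (pi : {rmorphism A -> F}),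
  forall a, pi a = 0 <-> P a.
Proof.
exists {fraction prime_quot}, (@tofrac prime_quot \o prime_quot_pi) => a /=.
split=> [/eqP|/prime_quot_pi0 ->]; last by rewrite rmorph0.
by rewrite tofrac_eq0 => /eqP /prime_quot_pi0.
Qed.

End ResidueField.


(** * Suprema, ideals and primes *)

Section NatSup.

Lemma bounded_max (P : nat -> Prop) b : (exists n, P n) ->
  (forall n, P n -> n <= b) -> exists m, P m /\ forall n, P n -> n <= m.
Proof.
elim: b => [|b IH] [n Pn] hb.
  by exists n; split=> // i /hb; rewrite leqn0 => /eqP ->.
case: (pselect (P b.+1)) => [Pb|nPb]; first by exists b.+1; split.
apply: IH; first by exists n.
move=> i Pi; have := hb i Pi; rewrite leq_eqVlt => /orP[/eqP ei|//].
by case: nPb; rewrite -ei.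
Qed.

(** [natsup] is arbitrary when there is no maximum, so each use of it must come with a witness and a
    bound. *)
Lemma natsupP (P : nat -> Prop) b : (exists n, P n) ->
  (forall n, P n -> n <= b) -> P (natsup P) /\ forall n, P n -> n <= natsup P.
Proof.
move=> h0 hb; have h := bounded_max h0 hb.
exact: (epsilon_spec (inhabits 0) _ h).
Qed.

Lemma natsup_ge (P : nat -> Prop) b n :
  (forall i, P i -> i <= b) -> P n -> n <= natsup P.
Proof. by move=> hb Pn; apply: (proj2 (natsupP _ hb)) => //; exists n. Qed.

Lemma eq_natsup (P Q : nat -> Prop) : (forall n, P n <-> Q n) -> natsup P = natsup Q.
Proof. by move=> h; congr natsup; apply/funext => n; apply/propext. Qed.

End NatSup.

Section Ideals.
Local Open Scope ring_scope.

Lemma subset_eq (A : Type) (P Q : A -> Prop) :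
  (forall x, P x -> Q x) -> (forall x, Q x -> P x) -> P = Q.
Proof. by move=> h1 h2; apply/funext => x; apply/propext; split; auto. Qed.

Lemma not_subset (A : Type) (P Q : A -> Prop) :
  ~ (forall x, P x -> Q x) -> exists x, P x /\ ~ Q x.
Proof.
move=> h; apply: contrapT => hn; apply: h => x Px; apply: contrapT => nQ.
by apply: hn; exists x.
Qed.

Lemma zorn_sets (T : Type) (good : (T -> Prop) -> Prop) (X0 : T -> Prop) :
  good X0 -> (forall J, good J -> exists x, J x) ->
  (forall F : (T -> Prop) -> Prop, (exists J, F J) -> (forall J, F J -> good J) ->
    (forall J K, F J -> F K ->
      (forall x, J x -> K x) \/ (forall x, K x -> J x)) ->
    good (fun x => exists J, F J /\ J x)) ->
  exists P, good P /\
    forall Q, good Q -> (forall x, P x -> Q x) -> forall x, Q x -> P x.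
Proof.
move=> g0 ne hU.
have [|P [gP Pmax]] := @classical_sets.Zorn_bigcup T
    (fun J => (forall x, ~ J x) \/ good J).
  move=> F FP Ftot.
  case: (pselect (exists J, F J /\ exists x, J x)) => [[J0 [FJ0 hJ0]]|hno]; last first.
    by left=> x [J FJ Jx]; apply: hno; exists J; split=> //; exists x.
  right; pose G J := F J /\ exists x : T, J x.
  have -> : classical_sets.bigcup F id = fun x => exists J, G J /\ J x.
    apply: subset_eq => x [J]; first by move=> FJ Jx; exists J; split=> //; split=> //; exists x.
    by move=> [[FJ _] Jx]; exists J.
  apply: hU; first by exists J0.
    by move=> J [FJ [x Jx]]; case: (FP J FJ) => // /(_ x).
  by move=> J K [FJ _] [FK _]; exact: Ftot.
case: gP => [hn|gP].
  case: (Pmax X0); last by right.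
  split; first by move=> x Px; case: (hn x).
  by move=> h; have [x hx] := ne _ g0; apply: (hn x); apply: h.
exists P; split=> // Q gQ PQ x Qx; apply: contrapT => nPx.
by case: (Pmax Q); [split=> // h; apply: nPx; apply: h|right].
Qed.

Section IdealTheory.
Variable A : comNzRingType.
Implicit Types (P I : A -> Prop).

Lemma ideal0 I : is_ideal I -> I 0. Proof. by case. Qed.
Lemma idealD I x y : is_ideal I -> I x -> I y -> I (x + y).
Proof. by case=> _ [h _]; apply: h. Qed.
Lemma ideal_mull I a x : is_ideal I -> I x -> I (a * x).
Proof. by case=> _ [_ h]; apply: h. Qed.
Lemma ideal_mulr I a x : is_ideal I -> I x -> I (x * a).
Proof. by rewrite mulrC; apply: ideal_mull. Qed.
Lemma idealN I x : is_ideal I -> I x -> I (- x).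
Proof. by move=> hI hx; rewrite -mulN1r; apply: ideal_mull. Qed.
Lemma idealB I x y : is_ideal I -> I x -> I y -> I (x - y).
Proof. by move=> hI hx hy; apply: idealD => //; apply: idealN. Qed.
Lemma ideal_sum I (T : Type) (r : seq T) (p : pred T) (F : T -> A) :
  is_ideal I -> (forall i, p i -> I (F i)) -> I (\sum_(i <- r | p i) F i).
Proof.
move=> hI h; elim/big_ind: _ => //; first exact: ideal0.
by move=> x y; apply: idealD.
Qed.

Lemma prime_ideal P : is_prime P -> is_ideal P. Proof. by case. Qed.
Lemma prime1 P : is_prime P -> ~ P 1. Proof. by case=> _ []. Qed.
Lemma primeM P x y : is_prime P -> P (x * y) -> P x \/ P y.
Proof. by case=> _ [_ h]; apply: h. Qed.

Lemma zero_prime : is_domain A -> is_prime (fun x : A => x = 0).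
Proof.
move=> dom; split; last split; last exact: dom.
  by split=> //; split=> [x y -> ->|a x ->]; rewrite ?addr0 ?mulr0.
by move/eqP; rewrite oner_eq0.
Qed.

Definition ideal_adjoin I z : A -> Prop := fun t => exists u v, I u /\ t = u + v * z.

Lemma ideal_adjoin_ideal I z : is_ideal I -> is_ideal (ideal_adjoin I z).
Proof.
move=> hI; split; first by exists 0, 0; split; [exact: ideal0|ring].
split=> [_ _ [u [v [Iu ->]]] [u' [v' [Iu' ->]]]|a _ [u [v [Iu ->]]]].
  by exists (u + u'), (v + v'); split; [exact: idealD|ring].
by exists (a * u), (a * v); split; [exact: ideal_mull|ring].
Qed.

Lemma ideal_adjoin_sub I z t : I t -> ideal_adjoin I z t.
Proof. by move=> It; exists t, 0; split=> //; ring. Qed.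

Lemma ideal_adjoin_mem I z : is_ideal I -> ideal_adjoin I z z.
Proof. by move=> hI; exists 0, 1; split; [exact: ideal0|ring]. Qed.

Lemma maximal_prime P : is_maximal P -> is_prime P.
Proof.
move=> [hI [h1 hm]]; split=> //; split=> // x y hxy.
case: (hm _ (ideal_adjoin_ideal x hI)).
- by move=> z; exact: ideal_adjoin_sub.
- by move=> h; left; apply: h; exact: ideal_adjoin_mem.
- move=> [u [v [Pu e]]]; right.
  have -> : y = u * y + v * (x * y) by rewrite mulrA -mulrDl -e mul1r.
  by apply: idealD => //; [exact: ideal_mulr|exact: ideal_mull].
Qed.

(** An ideal maximal among those containing [I] and missing [S] is prime: adjoining either of two
    elements outside it meets [S], and if their product were inside, multiplying the two elements of
    [S] so found would give one in the ideal. *)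
Lemma prime_avoidance I (S : A -> Prop) :
  is_ideal I -> S 1 -> (forall x y, S x -> S y -> S (x * y)) ->
  (forall x, S x -> ~ I x) ->
  exists P, is_prime P /\ (forall x, I x -> P x) /\ (forall x, S x -> ~ P x).
Proof.
move=> hI S1 SM SI.
pose good (J : A -> Prop) :=
  is_ideal J /\ (forall x, I x -> J x) /\ (forall x, S x -> ~ J x).
have gI : good I by [].
have [||P [gP Pmax]] := @zorn_sets A good I gI.
- by move=> J [hJ _]; exists 0; apply: ideal0.
- move=> F [J0 FJ0] Fgood Ftot; have [hJ0 [IJ0 _]] := Fgood _ FJ0.
  split; last split.
  + split; first by exists J0; split=> //; apply: ideal0.
    split=> [x y [J [FJ Jx]] [K [FK Ky]]|a x [J [FJ Jx]]]; last first.
      by exists J; split=> //; apply: ideal_mull => //; case: (Fgood _ FJ).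
    have [gJ _] := Fgood _ FJ; have [gK _] := Fgood _ FK.
    case: (Ftot J K FJ FK) => h; [exists K|exists J]; split=> //; apply: idealD => //; exact: h.
  + by move=> x Ix; exists J0; split=> //; apply: IJ0.
  + by move=> x Sx [J [FJ Jx]]; case: (Fgood _ FJ) => _ [_ /(_ x Sx)].
have [hP [IP SP]] := gP; exists P; split=> //; split=> //; split; first exact: SP.
have key z : ~ P z -> exists t, S t /\ ideal_adjoin P z t.
  move=> nPz; apply: contrapT => hn; apply: nPz; apply: (Pmax (ideal_adjoin P z)).
  - split; first exact: ideal_adjoin_ideal.
    split=> [x /IP|x Sx Jx]; first exact: ideal_adjoin_sub.
    by apply: hn; exists x.
  - by move=> t; exact: ideal_adjoin_sub.
  - exact: ideal_adjoin_mem.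
move=> x y Pxy; apply: contrapT => /not_orP[/key [s [Ss [u [v [Pu e]]]]]].
move=> /key [s' [Ss' [u' [v' [Pu' e']]]]].
apply: (SP _ (SM _ _ Ss Ss')); rewrite e e'.
have -> : (u + v * x) * (u' + v' * y) =
  u * (u' + v' * y) + ((v * x) * u' + (v * v') * (x * y)) by ring.
by apply: idealD => //; [exact: ideal_mulr|apply: idealD => //; exact: ideal_mull].
Qed.

End IdealTheory.

Lemma prime_preim (A B : comNzRingType) (f : {rmorphism A -> B}) (P : B -> Prop) :
  is_prime P -> is_prime (fun x => P (f x)).
Proof.
move=> [hI [h1 hM]]; split; last split; rewrite ?rmorph1 //.
  split; first by rewrite rmorph0; exact: ideal0.
  by split=> [x y hx hy|a x hx]; rewrite ?rmorphD ?rmorphM; [exact: idealD|exact: ideal_mull].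
by move=> x y; rewrite rmorphM => /hM.
Qed.

Lemma ext_ideal_map (A : comNzRingType) (F : nzRingType) (pi : {rmorphism A -> F})
    (P : A -> Prop) n (f : {mpoly A[n]}) :
  (forall a, pi a = 0 <-> P a) -> ext_ideal n P f <-> map_mpoly pi f = 0.
Proof.
move=> h; split=> [hf|hf].
  by apply/mpolyP => m; rewrite mcoeff_map_mpoly mcoeff0; apply/h.
by move=> m; apply/h; rewrite -mcoeff_map_mpoly hf mcoeff0.
Qed.

(** Reduction of coefficients modulo P lands in a polynomial ring over a field, and its kernel is
    [ext_ideal n P]. *)
Lemma ext_prime (A : comNzRingType) (P : A -> Prop) n :
  is_prime P -> is_prime (ext_ideal n P).
Proof.
move=> hP; have [F [pi hpi]] := residue_field hP.
have -> : ext_ideal n P = fun f => (map_mpoly pi f : {mpoly F[n]}) = 0.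
  by apply: subset_eq => f /(ext_ideal_map _ hpi).
apply: (@prime_preim _ _ (map_mpoly pi) (fun x => x = 0)); apply: zero_prime.
by move=> x y /eqP; rewrite mulf_eq0 => /orP[/eqP ->|/eqP ->]; [left|right].
Qed.

Lemma ext_ideal_mpolyC (A : comNzRingType) (P : A -> Prop) n a :
  is_ideal P -> ext_ideal n P a%:MP <-> P a.
Proof.
move=> hP; split=> [/(_ 0%MM)|Pa m]; rewrite mcoeffC ?eqxx ?mulr1 //.
exact: ideal_mulr.
Qed.

Lemma ext_ideal_mono (A : comNzRingType) (P Q : A -> Prop) n :
  (forall x, P x -> Q x) -> forall f, ext_ideal n P f -> ext_ideal n Q f.
Proof. by move=> h f hf m; apply: h. Qed.

Lemma mmap_ideal (A B : comNzRingType) n (g : {rmorphism A -> B}) (x : 'I_n -> B)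
    (P : A -> Prop) (Q : B -> Prop) f :
  is_ideal Q -> (forall a, P a -> Q (g a)) -> ext_ideal n P f -> Q (mmap g x f).
Proof. by move=> hQ h hf; apply: ideal_sum => // m _; apply: ideal_mulr => //; apply: h. Qed.

End Ideals.

Section KalgHom.
Local Open Scope ring_scope.
Variables (k : fieldType) (A B : comAlgType k) (f : A -> B).

Definition hom_of (hf : kalg_hom f) : A -> B := f.
Variable hf : kalg_hom f.

Fact hom_of_zmod : zmod_morphism (hom_of hf).
Proof.
have [hD [hM [h1 hZ]]] := hf; move=> x y.
by rewrite /hom_of -scaleN1r hD hZ scaleN1r.
Qed.
Fact hom_of_monoid : monoid_morphism (hom_of hf).
Proof. by have [hD [hM [h1 hZ]]] := hf; split. Qed.
HB.instance Definition _ := GRing.isZmodMorphism.Build A B (hom_of hf) hom_of_zmod.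
HB.instance Definition _ := GRing.isMonoidMorphism.Build A B (hom_of hf) hom_of_monoid.

Lemma kalg_homE : exists g : {rmorphism A -> B},
  (forall x, g x = f x) /\ forall c : k, g c%:A = c%:A.
Proof.
exists (hom_of hf); split=> // c; have [_ [_ [h1 hZ]]] := hf.
by change (f (c *: 1) = c *: 1); rewrite hZ h1.
Qed.
End KalgHom.


(** * Tensor products *)

Section Tensor.
Local Open Scope ring_scope.
Variables (k : fieldType) (A B : comAlgType k).

Definition balanced (V : zmodType) (f : A -> B -> V) :=
  [/\ forall a a' b, f (a + a') b = f a b + f a' b,
      forall a b b', f a (b + b') = f a b + f a b'
    & forall (c : k) a b, f (c *: a) b = f a (c *: b)].

Section Model.
Variable V : zmodType.

Definition bmap := {f : A -> B -> V | balanced f}.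
Definition bapp (f : bmap) : A -> B -> V := sval f.
Coercion bapp : bmap >-> Funclass.

(** Translation of balanced maps by a simple tensor is what multiplication on the model is made
    of. *)
Fact shift_balanced (p : A * B) (f : bmap) :
  balanced (fun a b => f (p.1 * a) (p.2 * b)).
Proof.
case: f => f [h1 h2 h3]; split=> [a a' b|a b b'|c a b]; rewrite /bapp /= ?mulrDr ?h1 ?h2 //.
by rewrite -!scalerAr h3.
Qed.
Definition shift p f : bmap := exist _ _ (shift_balanced p f).

Definition ev_seq (s : seq (A * B)) (f : bmap) : V := \sum_(p <- s) f p.1 p.2.

(* The tensor product, as the sums of simple tensors seen through all balanced
   maps to a fixed group [V]; [f0] makes it a nonzero ring. *)
Definition tmodel (f0 : {f : bmap | f 1 1 != 0}) :=
  {e : bmap -> V | exists s, forall f, e f = ev_seq s f}.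

Variable f0 : {f : bmap | f 1 1 != 0}.
Notation E := (tmodel f0).
Definition tapp (e : E) : bmap -> V := sval e.

HB.instance Definition _ := gen_eqMixin E.
HB.instance Definition _ := gen_choiceMixin E.

Fact tmodel_ext (e e' : E) : (forall f, tapp e f = tapp e' f) -> e = e'.
Proof.
case: e e' => [e he] [e' he']; rewrite /tapp /= => h.
have ee : e = e' by apply/funext.
by rewrite -ee in he' *; congr exist; apply: Prop_irrelevance.
Qed.

Definition trep (e : E) : seq (A * B) := projT1 (cid (svalP e)).
Fact trepP (e : E) f : tapp e f = ev_seq (trep e) f.
Proof. by rewrite /trep; case: cid. Qed.

Definition tev (s : seq (A * B)) : E :=
  exist _ (ev_seq s) (ex_intro _ s (fun=> erefl)).

Fact tadd_subproof (e e' : E) : exists s, forall f, tapp e f + tapp e' f = ev_seq s f.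
Proof. by exists (trep e ++ trep e') => f; rewrite /ev_seq big_cat /= -!/(ev_seq _ _) -!trepP. Qed.
Definition tadd (e e' : E) : E := exist _ _ (tadd_subproof e e').

Fact bmapN (f : bmap) a b : f (- a) b = - f a b.
Proof.
case: f => f [h1 h2 h3]; rewrite /bapp /=; apply/eqP.
rewrite -subr_eq0 opprK -h1 addNr.
by have := h1 0 0 b; rewrite addr0 => /eqP; rewrite -subr_eq0 opprD addrA subrr sub0r oppr_eq0.
Qed.

Fact topp_subproof (e : E) : exists s, forall f, - tapp e f = ev_seq s f.
Proof.
exists [seq (- p.1, p.2) | p <- trep e] => f.
rewrite /ev_seq big_map trepP /ev_seq -sumrN; apply: eq_bigr => p _.
by rewrite bmapN.
Qed.
Definition topp (e : E) : E := exist _ _ (topp_subproof e).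

Fact tmodel_addA : associative tadd.
Proof. by move=> x y z; apply: tmodel_ext => f; exact: addrA. Qed.
Fact tmodel_addC : commutative tadd.
Proof. by move=> x y; apply: tmodel_ext => f; exact: addrC. Qed.
Fact tmodel_add0 : left_id (tev [::]) tadd.
Proof. by move=> x; apply: tmodel_ext => f; rewrite /tapp /= /ev_seq big_nil add0r. Qed.
Fact tmodel_addN : left_inverse (tev [::]) topp tadd.
Proof. by move=> x; apply: tmodel_ext => f; rewrite /tapp /= /ev_seq big_nil; exact: addNr. Qed.

HB.instance Definition _ :=
  GRing.isZmodule.Build E tmodel_addA tmodel_addC tmodel_add0 tmodel_addN.

Fact tmul_subproof (e e' : E) :
  exists s, forall f, \sum_(p <- trep e) tapp e' (shift p f) = ev_seq s f.
Proof.
exists [seq (p.1 * p'.1, p.2 * p'.2) | p <- trep e, p' <- trep e'] => f.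
rewrite /ev_seq big_allpairs_dep; apply: eq_bigr => p _; rewrite trepP.
by apply: eq_bigr.
Qed.
Definition tmul (e e' : E) : E := exist _ _ (tmul_subproof e e').

(** The product is defined through the chosen representation [trep e]; exchanging the two sums shows
    that any other representation of [e] gives the same value. *)
Fact tmulE (e e' : E) s f : (forall f, tapp e f = ev_seq s f) ->
  tapp (tmul e e') f = \sum_(p <- s) tapp e' (shift p f).
Proof.
move=> hs; transitivity (\sum_(p <- trep e) tapp e' (shift p f)); first by [].
under eq_bigr do rewrite trepP; rewrite exchange_big /=.
under [RHS]eq_bigr do rewrite trepP; rewrite [RHS]exchange_big /=.
apply: eq_bigr => p _.
have sh q : f (q.1 * p.1) (q.2 * p.2) = bapp (shift p f) q.1 q.2.
  by rewrite /bapp /= [p.1 * _]mulrC [p.2 * _]mulrC.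
under eq_bigr do rewrite sh; under [RHS]eq_bigr do rewrite sh.
by rewrite -!/(ev_seq _ _) -trepP hs.
Qed.

Fact tmodel_mulC : commutative tmul.
Proof.
move=> x y; apply: tmodel_ext => f.
rewrite (tmulE _ _ (trepP x)) (tmulE _ _ (trepP y)).
under eq_bigr do rewrite trepP; rewrite exchange_big /=.
under [RHS]eq_bigr do rewrite trepP.
apply: eq_bigr => p _; apply: eq_bigr => q _.
by rewrite /bapp /= [p.1 * _]mulrC [p.2 * _]mulrC.
Qed.

Fact tmodel_mul1 : left_id (tev [:: (1, 1)]) tmul.
Proof.
move=> x; apply: tmodel_ext => f.
rewrite tmodel_mulC (tmulE _ _ (trepP x)) trepP; apply: eq_bigr => p _.
by rewrite /tapp /= /ev_seq big_seq1 /bapp /= !mulr1.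
Qed.

Fact tmodel_mulDl : left_distributive tmul tadd.
Proof.
move=> x y z; apply: tmodel_ext => f.
change (tapp (tmul (tadd x y) z) f = tapp (tmul x z) f + tapp (tmul y z) f).
rewrite (tmodel_mulC (tadd x y)) (tmodel_mulC x) (tmodel_mulC y) !(tmulE _ _ (trepP z)) -big_split.
by apply: eq_bigr.
Qed.

Fact tmodel_mulA : associative tmul.
Proof.
move=> x y z; apply: tmodel_ext => f.
rewrite (tmulE _ _ (trepP x)) [in RHS]tmodel_mulC (tmulE _ _ (trepP z)).
under eq_bigr do rewrite (tmulE _ _ (trepP y)).
under [RHS]eq_bigr do rewrite (tmulE _ _ (trepP x)).
under eq_bigr do under eq_bigr do rewrite trepP.
under [RHS]eq_bigr do under eq_bigr do rewrite trepP.
rewrite [RHS]exchange_big; apply: eq_bigr => p _; rewrite /= exchange_big.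
apply: eq_bigr => r _; apply: eq_bigr => q _.
by rewrite /bapp /=; congr (sval f _ _); ring.
Qed.

Fact tmodel_nonzero : tev [:: (1, 1)] != tev [::].
Proof.
apply/eqP => h; have [f hf] := f0; move/eqP: hf; apply.
have := congr1 (fun e => tapp e f) h.
by rewrite /tapp /= /ev_seq big_seq1 big_nil.
Qed.

HB.instance Definition _ := GRing.Zmodule_isComNzRing.Build E
  tmodel_mulA tmodel_mulC tmodel_mul1 tmodel_mulDl tmodel_nonzero.

Lemma tevM a b a' b' : tev [:: (a, b)] * tev [:: (a', b')] = tev [:: (a * a', b * b')].
Proof.
apply: tmodel_ext => f; rewrite (@tmulE _ _ [:: (a, b)]) // big_seq1.
by rewrite /tapp /= /ev_seq !big_seq1.
Qed.
Lemma tevDl a a' b : tev [:: (a + a', b)] = tev [:: (a, b)] + tev [:: (a', b)].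
Proof.
apply: tmodel_ext => f; rewrite /tapp /= /ev_seq !big_seq1 /=.
by have [h _ _] := svalP f; exact: h.
Qed.
Lemma tevDr a b b' : tev [:: (a, b + b')] = tev [:: (a, b)] + tev [:: (a, b')].
Proof.
apply: tmodel_ext => f; rewrite /tapp /= /ev_seq !big_seq1 /=.
by have [_ h _] := svalP f; exact: h.
Qed.
Lemma tevZ (c : k) a b : tev [:: (c *: a, b)] = tev [:: (a, c *: b)].
Proof.
apply: tmodel_ext => f; rewrite /tapp /= /ev_seq !big_seq1 /=.
by have [_ _ h] := svalP f; exact: h.
Qed.

Definition tscale (c : k) (e : E) : E := tev [:: (c%:A, 1)] * e.
Fact tmodel_scaleA a b v : tscale a (tscale b v) = tscale (a * b) v.
Proof. by rewrite /tscale mulrA tevM mulr1 -scalerAl mul1r scalerA. Qed.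
Fact tmodel_scale1 : left_id 1 tscale.
Proof. by move=> v; rewrite /tscale scale1r mul1r. Qed.
Fact tmodel_scaleDr : right_distributive tscale +%R.
Proof. by move=> a u v; rewrite /tscale mulrDr. Qed.
Fact tmodel_scaleDl v : {morph tscale^~ v : a b / a + b}.
Proof. by move=> a b; rewrite /tscale scalerDl tevDl mulrDl. Qed.
HB.instance Definition _ := GRing.Zmodule_isLmodule.Build k E
  tmodel_scaleA tmodel_scale1 tmodel_scaleDr tmodel_scaleDl.
Fact tmodel_scaleAl (a : k) (u v : E) : a *: (u * v) = a *: u * v.
Proof. exact: mulrA. Qed.
HB.instance Definition _ := GRing.Lmodule_isLalgebra.Build k E tmodel_scaleAl.
HB.instance Definition _ := GRing.Lalgebra_isComAlgebra.Build k E.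

Lemma tev_hom1 : kalg_hom (fun a => tev [:: (a, 1)]).
Proof.
split; first by move=> x y; rewrite tevDl.
split; first by move=> x y; rewrite tevM mulr1.
by split=> // c x; rewrite [RHS]tevM -scalerAl !mul1r.
Qed.
Lemma tev_hom2 : kalg_hom (fun b => tev [:: (1, b)]).
Proof.
split; first by move=> x y; rewrite tevDr.
split; first by move=> x y; rewrite tevM mulr1.
by split=> // c x; rewrite [RHS]tevM mulr1 mul1r tevZ.
Qed.

End Model.

Section Universal.
Variables (C : comAlgType k) (j1 : A -> C) (j2 : B -> C).
Hypothesis hC : is_tensor j1 j2.

Lemma simple_balanced : balanced (fun a b => j1 a * j2 b).
Proof.
have [[hD1 [_ [_ hZ1]]] [[hD2 [_ [_ hZ2]]] _]] := hC.
split=> [a a' b|a b b'|c a b]; rewrite ?hD1 ?hD2 ?mulrDl ?mulrDr //.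
by rewrite hZ1 hZ2 -scalerAl -scalerAr.
Qed.

(** The universal property yields an algebra map from C to the model, and evaluating the elements of
    the model at the balanced map is additive. *)
Lemma tensor_lift (V : zmodType) (f : A -> B -> V) : balanced f ->
  exists F : C -> V, (forall x y, F (x + y) = F x + F y) /\
    forall a b, F (j1 a * j2 b) = f a b.
Proof.
move=> hf; have hb := simple_balanced.
have [hj1 [hj2 hu]] := hC.
(* The factor C makes the model nonzero. *)
pose f0 a b : (C * V)%type := (j1 a * j2 b, 0).
pose f1 a b : (C * V)%type := (0, f a b).
have hf0 : balanced f0.
  by case: hb => h1 h2 h3; split=> [a a' b|a b b'|c a b]; rewrite /f0 ?h1 ?h2 ?h3 //;
   congr (_, _); rewrite addr0.
have hf1 : balanced f1.
  by case: hf => h1 h2 h3; split=> [a a' b|a b b'|c a b]; rewrite /f1 ?h1 ?h2 ?h3 //;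
   congr (_, _); rewrite addr0.
have nz : bapp (exist _ f0 hf0 : bmap (C * V)%type) 1 1 != 0.
  have [_ [_ [e1 _]]] := hj1; have [_ [_ [e2 _]]] := hj2.
  rewrite /bapp /= /f0 e1 e2 mulr1; apply/eqP => -[/eqP].
  by rewrite oner_eq0.
pose z := exist (fun f : bmap (C * V)%type => f 1 1 != 0) _ nz.
have [h [[hD [hM _]] [h1 [h2 _]]]] := hu _ _ _ (tev_hom1 z) (tev_hom2 z).
exists (fun c => (tapp (h c) (exist _ f1 hf1)).2); split=> [x y|a b].
  by rewrite hD.
by rewrite hM h1 h2 tevM mulr1 mul1r /tapp /= /ev_seq big_seq1.
Qed.

(** Mapping C to the model and evaluating there at the product map is an algebra endomorphism of C
    that fixes both factors. By uniqueness it is the identity, and its values are finite sums of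
    simple tensors. *)
Lemma tensor_gen (c : C) : exists s : seq (A * B), c = \sum_(p <- s) j1 p.1 * j2 p.2.
Proof.
have hb := simple_balanced.
have [hj1 [hj2 hu]] := hC.
have [_ [m1 [e1 _]]] := hj1; have [_ [m2 [e2 z2]]] := hj2.
pose f0 : bmap C := exist _ _ hb.
have nz : f0 1 1 != 0 by rewrite /f0 /bapp /= e1 e2 mulr1 oner_neq0.
pose z := exist (fun f : bmap C => f 1 1 != 0) _ nz.
have [h [hh [h1 [h2 _]]]] := hu _ _ _ (tev_hom1 z) (tev_hom2 z).
have [hD [hM [hone hZ]]] := hh.
pose g (e : tmodel z) : C := tapp e f0.
have gM x y : g (x * y) = g x * g y.
  rewrite /g (tmulE _ _ (trepP x)) trepP mulr_suml; apply: eq_bigr => p _.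
  rewrite !trepP mulr_sumr; apply: eq_bigr => q _.
  by rewrite /f0 /bapp /= m1 m2; ring.
have g1 a : g (h (j1 a)) = j1 a.
  by rewrite h1 /g /tapp /= /ev_seq big_seq1 /f0 /bapp /= e2 mulr1.
have g2 b : g (h (j2 b)) = j2 b.
  by rewrite h2 /g /tapp /= /ev_seq big_seq1 /f0 /bapp /= e1 mul1r.
have [h' [_ [_ [_ huniq]]]] := hu _ _ _ hj1 hj2.
have gh : kalg_hom (g \o h).
  split; first by move=> x y; rewrite /= hD.
  split; first by move=> x y; rewrite /= hM gM.
  have gh1 : (g \o h) 1 = 1 by rewrite /= -[in LHS]e1 g1.
  split=> // a x; have e : a *: x = j2 a%:A * x by rewrite z2 e2 -scalerAl mul1r.
  by rewrite /= e hM gM g2 z2 e2 -scalerAl mul1r.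
have id_hom : kalg_hom (@id C) by [].
have /= <- : (g \o h) c = c.
  by rewrite (huniq _ gh) //; apply: esym; apply: (huniq _ id_hom).
by exists (trep (h c)); rewrite /g trepP.
Qed.

End Universal.
End Tensor.

Lemma tensor_sym (k : fieldType) (A B C : comAlgType k) (j1 : A -> C) (j2 : B -> C) :
  is_tensor j1 j2 -> is_tensor j2 j1.
Proof.
move=> [h1 [h2 hu]]; split=> //; split=> // E f1 f2 hf1 hf2.
have [h [? [? [? huniq]]]] := hu E f2 f1 hf2 hf1.
by exists h; do !split=> //; move=> *; apply: huniq.
Qed.


(** * Going down in tensor products *)

Section Functional.
Local Open Scope ring_scope.
Variables (L B : comNzRingType) (K : fieldType).
Variables (g : {rmorphism L -> B}) (nu : {rmorphism L -> K}).
Hypothesis nu_inj : forall l, nu l = 0 -> l = 0.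

(** Submodules with torsion-free quotient: they stand for subspaces over the fraction field of [L]
    without localizing. *)
Definition saturated (W : B -> Prop) :=
  [/\ W 0, forall x y, W x -> W y -> W (x + y), forall l x, W x -> W (g l * x)
    & forall l x, l != 0 -> W (g l * x) -> W x].

Let nu_neq0 (l : L) : l != 0 -> nu l != 0.
Proof. by apply: contra_neq; exact: nu_inj. Qed.
Let L_neq0 (l l' : L) : l != 0 -> l' != 0 -> l * l' != 0.
Proof.
move=> /nu_neq0 h /nu_neq0 h'; apply/eqP => e.
by have := mulf_neq0 h h'; rewrite -rmorphM e rmorph0 eqxx.
Qed.

Lemma saturatedB W x y : saturated W -> W x -> W y -> W (x - y).
Proof.
case=> _ hD hM _ Wx Wy; apply: hD => //; rewrite -mulN1r.
by have := hM (-1) y Wy; rewrite rmorphN rmorph1.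
Qed.

(** Let W be maximal among the saturated submodules containing [W0] and missing [x]. Then B/W has
    rank one, spanned by [x], and [phi] is the coordinate along [x], carried to [K] by [nu]. *)
Lemma functional_extension (W0 : B -> Prop) (x : B) :
  saturated W0 -> ~ W0 x ->
  exists phi : B -> K, [/\ forall a b, phi (a + b) = phi a + phi b,
    forall l b, phi (g l * b) = nu l * phi b, forall b, W0 b -> phi b = 0 & phi x = 1].
Proof.
move=> sW0 nW0x.
pose good (W : B -> Prop) := saturated W /\ (forall b, W0 b -> W b) /\ ~ W x.
have g0 : good W0 by [].
have [||W [[sW [W0W nWx]] Wmax]] := @zorn_sets B good W0 g0.
- by move=> J [[h0 _ _ _] _]; exists 0.
- move=> F [J0 FJ0] Fgood Ftot; have [[J00 _ _ _] [W0J0 _]] := Fgood _ FJ0.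
  split; last first.
    split; first by move=> b /W0J0 hb; exists J0.
    by move=> [J [FJ Jx]]; case: (Fgood _ FJ) => _ [_ /(_ Jx)].
  split; first by exists J0.
  + move=> a b [J [FJ Ja]] [I [FI Ib]].
    have [[_ DJ _ _] _] := Fgood _ FJ; have [[_ DI _ _] _] := Fgood _ FI.
    case: (Ftot J I FJ FI) => h; [exists I|exists J]; split=> //; [apply: DI|apply: DJ] => //; exact: h.
  + by move=> l b [J [FJ Jb]]; exists J; split=> //; case: (Fgood _ FJ) => [[_ _ h _] _]; apply: h.
  + by move=> l b l0 [J [FJ Jb]]; exists J; split=> //; case: (Fgood _ FJ) => [[_ _ _ h] _]; apply: h l0 Jb.
have [W00 WD WM WS] := sW.
(* Rank one: if no nonzero multiple of [y] were a multiple of [x] modulo [W], the saturation of [W]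
   and [y] would still miss [x]. *)
have tot y : exists lm : L * L, lm.2 != 0 /\ W (g lm.2 * y - g lm.1 * x).
  case: (pselect (W y)) => [Wy|nWy].
    by exists (0, 1); rewrite /= oner_neq0 rmorph1 rmorph0 mul1r mul0r subr0.
  pose W' b := exists l m : L, l != 0 /\ W (g l * b - g m * y).
  have WW' b : W b -> W' b.
    by move=> Wb; exists 1, 0; rewrite oner_neq0 rmorph1 rmorph0 mul1r mul0r subr0.
  have W'y : W' y by exists 1, 1; rewrite oner_neq0 subrr.
  case: (pselect (W' x)) => [[l [m [l0 hl]]]|nW'x].
    exists (l, m); split=> /=; last first.
      have -> : g m * y - g l * x = g (-1) * (g l * x - g m * y) by rewrite rmorphN rmorph1; ring.
      exact: WM.
    apply/eqP => m0; move: hl; rewrite m0 rmorph0 mul0r subr0 => hl.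
    exact/nWx/(WS _ _ l0 hl).
  case: nWy; apply: (Wmax W') => //; split; last by split=> // b /W0W /WW'.
  split; first by apply: WW'.
  - move=> a b [l [m [l0 hl]]] [l' [m' [l0' hl']]].
    exists (l * l'), (l' * m + l * m'); split; first exact: L_neq0.
    have -> : g (l * l') * (a + b) - g (l' * m + l * m') * y =
      g l' * (g l * a - g m * y) + g l * (g l' * b - g m' * y).
      by rewrite rmorphD !rmorphM; ring.
    by apply: WD; apply: WM.
  - move=> n b [l [m [l0 hl]]]; exists l, (n * m); split=> //.
    have -> : g l * (g n * b) - g (n * m) * y = g n * (g l * b - g m * y).
      by rewrite !rmorphM; ring.
    exact: WM.
  - move=> n b n0 [l [m [l0 hl]]]; exists (l * n), m; split; first exact: L_neq0.
    by rewrite rmorphM -mulrA.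
pose rel y v := exists l m, [/\ m != 0, W (g m * y - g l * x) & v = nu l / nu m].
have rel_uniq y v v' : rel y v -> rel y v' -> v = v'.
  move=> [l [m [m0 h ->]]] [l' [m' [m0' h' ->]]].
  have : W (g (m' * l - m * l') * x).
    have -> : g (m' * l - m * l') * x =
      g m * (g m' * y - g l' * x) - g m' * (g m * y - g l * x).
      by rewrite rmorphB !rmorphM; ring.
    by apply: saturatedB => //; apply: WM.
  have [e _|e /(WS _ _ e)//] := eqVneq (m' * l - m * l') 0.
  apply/eqP; rewrite GRing.eqr_div ?nu_neq0 // -!rmorphM -subr_eq0 -rmorphB.
  by rewrite [l * _]mulrC [l' * _]mulrC e rmorph0.
have relT y : exists v, rel y v.
  by have [[l m] [m0 h]] := tot y; exists (nu l / nu m), l, m.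
pose phi y := projT1 (cid (relT y)).
have phiP y : rel y (phi y) by rewrite /phi; case: cid.
have phiE y v : rel y v -> phi y = v by move=> h; apply: rel_uniq h.
exists phi; split.
- move=> a b; apply: phiE; have [l [m [m0 h ->]]] := phiP a.
  have [l' [m' [m0' h' ->]]] := phiP b.
  exists (m' * l + m * l'), (m * m'); split; first exact: L_neq0.
    have -> : g (m * m') * (a + b) - g (m' * l + m * l') * x =
      g m' * (g m * a - g l * x) + g m * (g m' * b - g l' * x).
      by rewrite rmorphD !rmorphM; ring.
    by apply: WD; apply: WM.
  by rewrite rmorphD !rmorphM; field; rewrite !nu_neq0.
- move=> n b; apply: phiE; have [l [m [m0 h ->]]] := phiP b.
  exists (n * l), m; split=> //; last by rewrite rmorphM mulrA.
  have -> : g m * (g n * b) - g (n * l) * x = g n * (g m * b - g l * x).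
    by rewrite !rmorphM; ring.
  exact: WM.
- move=> b W0b; apply: phiE; exists 0, 1; split; rewrite ?oner_neq0 //.
    by rewrite rmorph0 rmorph1 mul0r subr0 mul1r; exact: W0W.
  by rewrite rmorph0 mul0r.
- apply: phiE; exists 1, 1; split; rewrite ?oner_neq0 ?subrr //.
  by rewrite rmorph1 divr1.
Qed.

End Functional.


(** * Morphisms out of polynomial rings *)

Section MpolyMorphisms.
Local Open Scope ring_scope.

Lemma mpoly_gen_ind (R : comNzRingType) n (P : {mpoly R[n]} -> Prop) :
  (forall c, P c%:MP) -> (forall i, P 'X_i) ->
  (forall p q, P p -> P q -> P (p + q)) -> (forall p q, P p -> P q -> P (p * q)) ->
  forall p, P p.
Proof.
move=> hC hX hD hM p; rewrite [p]mpolyE.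
have h0 : P 0 by rewrite -(mpolyC0 n R).
apply: (big_ind P) => // m _; rewrite -mul_mpolyC; apply: (hM) => //.
rewrite mpolyXE_id; apply: (big_ind P) => [|u v|i _]; first by rewrite -(mpolyC1 n R).
  exact: hM.
suff h j : P ('X_i ^+ j) by [].
elim: j => [|j IH]; first by rewrite expr0 -(mpolyC1 n R).
by rewrite exprS; apply: hM.
Qed.

Lemma mpoly_hom_eq (R : comNzRingType) (S : nzRingType) n
    (f g : {rmorphism {mpoly R[n]} -> S}) :
  (forall c, f c%:MP = g c%:MP) -> (forall i, f 'X_i = g 'X_i) -> f =1 g.
Proof.
move=> hC hX; apply: mpoly_gen_ind => // p q hp hq; first by rewrite !rmorphD hp hq.
by rewrite !rmorphM hp hq.
Qed.

Lemma mmapX_id (R : nzRingType) (S : comNzRingType) n (f : {rmorphism R -> S}) (h : 'I_n -> S) i :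
  mmap f h 'X_i = h i.
Proof. by rewrite mmapX mmap1U. Qed.

Lemma map_mpolyX_id (R S : nzRingType) n (f : {rmorphism R -> S}) i :
  map_mpoly f ('X_i : {mpoly R[n]}) = 'X_i.
Proof. by rewrite map_mpolyX. Qed.

Lemma mmap_map (R : comNzRingType) (S T : comNzRingType) n (f : {rmorphism R -> S})
   (g : {rmorphism S -> T}) (h : 'I_n -> T) p :
  mmap g h (map_mpoly f p) = mmap (g \o f) h p.
Proof.
pose F : {rmorphism _ -> _} := mmap g h \o map_mpoly f.
apply: (@mpoly_hom_eq _ _ _ F (mmap (g \o f) h)) => [c|i] /=.
  by rewrite map_mpolyC !mmapC.
by rewrite map_mpolyX_id !mmapX_id.
Qed.

Lemma rmorph_mmap (R : comNzRingType) (S T : comNzRingType) n (f : {rmorphism R -> S})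
   (g : {rmorphism S -> T}) (h : 'I_n -> S) p :
  g (mmap f h p) = mmap (g \o f) (g \o h) p.
Proof.
pose F : {rmorphism _ -> _} := g \o mmap f h.
apply: (@mpoly_hom_eq _ _ _ F (mmap (g \o f) (g \o h))) => [c|i] /=.
  by rewrite !mmapC.
by rewrite !mmapX_id.
Qed.

Lemma eq_mmap (R : comNzRingType) (S : comNzRingType) n (f g : {rmorphism R -> S})
   (h h' : 'I_n -> S) : f =1 g -> h =1 h' -> mmap f h =1 mmap g h'.
Proof.
move=> e e'; apply: (@mpoly_hom_eq _ _ _ (mmap f h) (mmap g h')) => [c|i] /=.
  by rewrite !mmapC; exact: e.
by rewrite !mmapX_id e'.
Qed.

Lemma additive_sum (U V : zmodType) (F : U -> V) (h : forall x z, F (x + z) = F x + F z)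
    (T : Type) (r : seq T) (G : T -> U) :
  F (\sum_(i <- r) G i) = \sum_(i <- r) F (G i).
Proof.
apply: (big_morph F h).
by apply: (addIr (F 0)); rewrite -h !add0r.
Qed.

End MpolyMorphisms.

Section GoingDown.
Local Open Scope ring_scope.
Variables (k : fieldType) (A B C : comAlgType k).
Variables (j1 : {rmorphism A -> C}) (j2 : {rmorphism B -> C}).
Hypothesis hC : is_tensor j1 j2.

Variables (m : nat) (y : 'I_m -> B).
Notation L := {mpoly k[m]}.
Notation gy := (mmap (in_alg B) y).
Notation emb := (@map_mpoly m k A (in_alg A)).

(** The map A[z] -> A (x) B with z_i going to 1 (x) y_i. *)
Definition theta : {mpoly A[m]} -> C := mmap j1 (j2 \o y).
HB.instance Definition _ := GRing.RMorphism.on theta.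

Lemma tensor_scalar (c : k) : j1 c%:A = j2 c%:A.
Proof.
have [[_ [_ [e1 z1]]] [[_ [_ [e2 z2]]] _]] := hC.
by rewrite z1 z2 e1 e2.
Qed.

Lemma theta_emb (l : L) : theta (emb l) = j2 (gy l).
Proof.
rewrite /theta mmap_map rmorph_mmap; apply: eq_mmap => // c /=.
exact: tensor_scalar.
Qed.

Lemma thetaC a : theta a%:MP = j1 a. Proof. exact: mmapC. Qed.
Lemma thetaX i : theta 'X_i = j2 (y i). Proof. exact: mmapX_id. Qed.

Variable q : B -> Prop.
Hypothesis hq : is_prime q.
Hypothesis hy : alg_indep_mod q y.

Let gy_q (l : L) : l != 0 -> ~ q (gy l). Proof. by move=> /hy. Qed.

Variable pp : {mpoly A[m]} -> Prop.
Hypothesis hpp : is_prime pp.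
(** This says that [pp] survives the localization that inverts the nonzero elements of k[z]. *)
Hypothesis pp_emb : forall l : L, pp (emb l) -> l = 0.

Section Fixed.
Variables (K : fieldType) (mu : {rmorphism {mpoly A[m]} -> K}).
Hypothesis hmu : forall r, mu r = 0 <-> pp r.

Let nu : {rmorphism L -> K} := mu \o emb.
Let nu_inj (l : L) : nu l = 0 -> l = 0. Proof. by move/hmu/pp_emb. Qed.

(** These are the k[z]-linear functionals on B/q with values in [K]; [induced] describes the map mu
    (x) phi on C. *)
Definition admissible (phi : B -> K) := [/\ forall a b, phi (a + b) = phi a + phi b,
  forall l b, phi (gy l * b) = nu l * phi b & forall b, q b -> phi b = 0].
Definition induced (phi : B -> K) (F : C -> K) := (forall x z, F (x + z) = F x + F z) /\
  (forall a b, F (j1 a * j2 b) = mu a%:MP * phi b).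

Lemma induced_exists phi : admissible phi -> exists F, induced phi F.
Proof.
move=> [hD hM _].
have [|F [FD FE]] := tensor_lift hC (f := fun a b => mu a%:MP * phi b); last by exists F.
split=> [a a' b|a b b'|c a b]; rewrite ?hD ?mulrDr //.
  by rewrite !rmorphD mulrDl.
have -> : (c *: a)%:MP_[m] = emb c%:MP * a%:MP.
  by rewrite map_mpolyC -mpolyCM /= -scalerAl mul1r.
have -> : c *: b = gy c%:MP * b by rewrite mmapC /= -scalerAl mul1r.
by rewrite hM rmorphM /= mulrCA mulrA.
Qed.

Lemma induced_theta phi F r c : admissible phi -> induced phi F ->
  F (theta r * c) = mu r * F c.
Proof.
move=> [hD hM _] [FD FE]; elim/mpoly_gen_ind: r c => [a|i|p p' hp hp'|p p' hp hp'] c.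
- have [s ->] := tensor_gen hC c.
  rewrite mulr_sumr !(additive_sum FD) mulr_sumr; apply: eq_bigr => pr _.
  by rewrite thetaC mulrA -rmorphM !FE mpolyCM rmorphM mulrA.
- have [s ->] := tensor_gen hC c.
  rewrite mulr_sumr !(additive_sum FD) mulr_sumr; apply: eq_bigr => pr _.
  rewrite thetaX mulrCA -rmorphM !FE -[y i](mmapX_id (in_alg B)) hM.
  by rewrite /nu /= map_mpolyX_id mulrCA.
- by rewrite rmorphD mulrDl FD hp hp' rmorphD mulrDl.
- by rewrite rmorphM -mulrA hp hp' rmorphM mulrA.
Qed.

(** The kernel of C -> K (x) B/q, tensored over k[z]. Describing it by functionals avoids
    constructing this second tensor product. *)
Definition kernel_ideal (c : C) := forall phi F, admissible phi -> induced phi F -> F c = 0.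

Lemma kernel_ideal_ideal : is_ideal kernel_ideal.
Proof.
split; first by move=> phi F _ [FD _]; apply: (addIr (F 0)); rewrite -FD !add0r.
split; first by move=> x z hx hz phi F hphi hF; have [FD _] := hF; rewrite FD (hx _ _ hphi hF) (hz _ _ hphi hF) addr0.
move=> a c hc phi F hphi hF; have [s ->] := tensor_gen hC a; have [FD FE] := hF.
rewrite mulr_suml (additive_sum FD) big1 // => -[a' b'] _ /=.
have [hD hM hk] := hphi.
(* Multiplication by b' on C is absorbed into the functional, which stays admissible. *)
have hphi' : admissible (fun b => phi (b' * b)).
  split=> [u v|l u|u qu]; rewrite ?mulrDr ?hD //.
    by rewrite mulrCA hM.
  by apply: hk; apply: ideal_mull => //; exact: prime_ideal.
have [F' hF'] := induced_exists hphi'.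
suff -> : F (j1 a' * j2 b' * c) = mu a'%:MP * F' c by rewrite (hc _ _ hphi' hF') mulr0.
have [F'D F'E] := hF'; have [s' ->] := tensor_gen hC c.
rewrite mulr_sumr (additive_sum FD) (additive_sum F'D) mulr_sumr; apply: eq_bigr => -[a'' b''] _ /=.
by rewrite mulrACA -!rmorphM FE F'E mpolyCM rmorphM mulrA.
Qed.

Section Span.
Variable b : nat -> B.
Variable n : nat.
Let S (c : nat -> L) := \sum_(0 <= i < n) gy (c i) * b i.
(** Membership in the span of b_0, ..., b_(n-1) in B/q over the fractions of k[z], with the
    denominator [l] cleared. *)
Definition dependent x := exists l (c : nat -> L), l != 0 /\ q (gy l * x - S c).

Lemma dependent_saturated : saturated gy dependent.
Proof.
have hI := prime_ideal hq.
have SD c c' l l' : S (fun i => l * c i + l' * c' i) = gy l * S c + gy l' * S c'.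
  rewrite /S !mulr_sumr -big_split; apply: eq_bigr => i _ /=.
  by rewrite rmorphD !rmorphM; ring.
have S0 : S (fun=> 0) = 0 by rewrite /S big1 // => i _; rewrite rmorph0 mul0r.
split.
- exists 1, (fun=> 0); split; first exact: oner_neq0.
  by rewrite S0 mulr0 subr0; exact: ideal0.
- move=> u v [l [c [l0 h]]] [l' [c' [l0' h']]].
  exists (l * l'), (fun i => l' * c i + l * c' i); split; first by rewrite mulf_neq0.
  rewrite SD rmorphM.
  have -> : gy l * gy l' * (u + v) - (gy l' * S c + gy l * S c') =
     gy l' * (gy l * u - S c) + gy l * (gy l' * v - S c') by ring.
  by apply: idealD => //; apply: ideal_mull.
- move=> n' u [l [c [l0 h]]]; exists l, (fun i => n' * c i + 0 * 0); split=> //.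
  rewrite (SD c (fun=> 0)) S0.
  have -> : gy l * (gy n' * u) - (gy n' * S c + gy 0 * 0) = gy n' * (gy l * u - S c) by ring.
  exact: ideal_mull.
- move=> n' u n0 [l [c [l0 h]]]; exists (l * n'), c; split; first by rewrite mulf_neq0.
  by rewrite rmorphM -mulrA.
Qed.

Lemma dependent_q x : q x -> dependent x.
Proof.
move=> qx; exists 1, (fun=> 0); split; first exact: oner_neq0.
rewrite /S big1 => [|i _]; last by rewrite rmorph0 mul0r.
by rewrite rmorph1 mul1r subr0.
Qed.

Lemma dependent_gen i : (i < n)%N -> dependent (b i).
Proof.
move=> lt_in; exists 1, (fun j => (j == i)%:R); split; first exact: oner_neq0.
rewrite /S big_mkord (bigD1 (Ordinal lt_in)) //= eqxx big1 ?addr0 ?subrr.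
  by apply: ideal0; exact: prime_ideal.
by move=> j; rewrite -val_eqE /= => /negbTE ->; rewrite rmorph0 mul0r.
Qed.

End Span.

(* The kernel ideal lies in every prime over q containing theta(pp): solve for
   the last term of a representation if its second factor is dependent on the
   others, and otherwise separate it by a dual functional. *)
Lemma kernel_ideal_sub (P : C -> Prop) : is_prime P ->
  (forall x, P (j2 x) <-> q x) -> (forall r, pp r -> P (theta r)) ->
  forall c, kernel_ideal c -> P c.
Proof.
move=> hP Pq Ppp c hc; have hI := prime_ideal hP.
(* The coefficients are taken in A[z] rather than A because solving for the last term multiplies
   them by elements of k[z]. *)
suff key n (r : nat -> {mpoly A[m]}) (b : nat -> B) :
    (forall phi, admissible phi -> \sum_(0 <= i < n) mu (r i) * phi (b i) = 0) ->
    P (\sum_(0 <= i < n) theta (r i) * j2 (b i)).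
  have [s es] := tensor_gen hC c.
  rewrite es (big_nth (0, 0)).
  under eq_bigr do rewrite -thetaC.
  apply: (key _ (fun i => (nth (0, 0) s i).1%:MP) (fun i => (nth (0, 0) s i).2)).
  move=> phi hphi; have [F hF] := induced_exists hphi.
  have := hc _ _ hphi hF; rewrite es (big_nth (0, 0)).
  have [FD FE] := hF; rewrite (additive_sum FD) => e; rewrite -[RHS]e.
  by apply: eq_bigr => i _; rewrite FE.
elim: n r b => [|n IH] r b h; first by rewrite big_nil; exact: ideal0.
have sW := dependent_saturated b n.
case: (pselect (dependent b n (b n))) => [[l [c' [l0 hl]]]|nd].
  have : P (j2 (gy l) * \sum_(0 <= i < n.+1) theta (r i) * j2 (b i)).
    pose r' i := emb l * r i + emb (c' i) * r n.
    have -> : j2 (gy l) * \sum_(0 <= i < n.+1) theta (r i) * j2 (b i) =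
      \sum_(0 <= i < n) theta (r' i) * j2 (b i) +
      theta (r n) * j2 (gy l * b n - \sum_(0 <= i < n) gy (c' i) * b i).
      have -> : j2 (gy l * b n - \sum_(0 <= i < n) gy (c' i) * b i) =
          theta (emb l) * j2 (b n) - \sum_(0 <= i < n) theta (emb (c' i)) * j2 (b i).
        rewrite rmorphB rmorphM theta_emb; congr (_ - _).
        by rewrite rmorph_sum; apply: eq_bigr => i _; rewrite rmorphM theta_emb.
      have -> : \sum_(0 <= i < n) theta (r' i) * j2 (b i) =
          theta (emb l) * (\sum_(0 <= i < n) theta (r i) * j2 (b i)) +
          theta (r n) * \sum_(0 <= i < n) theta (emb (c' i)) * j2 (b i).
        rewrite !mulr_sumr -big_split; apply: eq_bigr => i _ /=.
        by rewrite /r' rmorphD !rmorphM; ring.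
      by rewrite big_nat_recr //= -theta_emb; ring.
    apply: idealD => //; last by apply: ideal_mull => //; apply/Pq.
    apply: IH => phi hphi; have [hD hM hk] := hphi.
    have e1 := hk _ hl.
    have eB u v : phi (u - v) = phi u - phi v.
      by rewrite hD -mulN1r -(rmorph1 (gy : {rmorphism L -> B})) -rmorphN hM rmorphN rmorph1 mulN1r.
    move: e1; rewrite eB hM (additive_sum hD) => /eqP; rewrite subr_eq0 => /eqP e1.
    have := congr1 ( *%R (nu l)) (h _ hphi); rewrite mulr0 big_nat_recr //= mulrDr => e2; rewrite -[RHS]e2.
    rewrite [_ * (mu (r n) * _)]mulrCA e1 !mulr_sumr -big_split; apply: eq_bigr => i _ /=.
    by rewrite hM /r' rmorphD !rmorphM /nu /=; ring.
  by case/(primeM hP) => // /Pq /(gy_q l0).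
have [phi [hD hM h0 h1]] := functional_extension nu_inj sW nd.
have hphi : admissible phi by split=> // x qx; apply: h0; exact: dependent_q.
have : mu (r n) = 0.
  have := h _ hphi; rewrite big_nat_recr //= h1 mulr1 big_nat big1 ?add0r // => i /= lt_in.
  by rewrite (h0 (b i)) ?mulr0 //; exact: dependent_gen.
move=> /hmu prn; rewrite big_nat_recr //=; apply: idealD => //; last first.
  by rewrite mulrC; apply: ideal_mull => //; apply: Ppp.
apply: IH => phi' hphi'; have := h _ hphi'; rewrite big_nat_recr //=.
by move/hmu: prn => ->; rewrite mul0r addr0.
Qed.

Lemma kernel_ideal_theta r : pp r -> kernel_ideal (theta r).
Proof.
move=> /hmu hr phi F hphi hF.
by rewrite -[theta r]mulr1 (induced_theta _ _ hphi hF) hr mul0r.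
Qed.

Lemma kernel_ideal_q x : q x -> kernel_ideal (j2 x).
Proof.
move=> qx phi F [_ _ hk] [_ FE].
by rewrite -[j2 x]mul1r -(rmorph1 j1) FE hk ?mulr0.
Qed.

End Fixed.

(* The multiplicative set generated by the complements of P and of theta(pp)
   misses the kernel ideal, because mu takes nonzero values off pp. *)
Lemma going_down (P : C -> Prop) : is_prime P -> (forall x, P (j2 x) <-> q x) ->
  (forall r, pp r -> P (theta r)) ->
  exists P', [/\ is_prime P', forall c, P' c -> P c, forall x, P' (j2 x) <-> q x
    & forall r, P' (theta r) <-> pp r].
Proof.
move=> hP Pq Ppp; have [K [mu hmu]] := residue_field hpp.
pose I := kernel_ideal mu; have hI : is_ideal I by apply: kernel_ideal_ideal.
have IP := kernel_ideal_sub hmu hP Pq Ppp.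
pose S c := exists r t, [/\ ~ pp r, ~ P t & c = theta r * t].
have S1 : S 1 by exists 1, 1; rewrite rmorph1 mulr1; split=> //; exact: prime1.
have [||P' [hP' [IP' SP']]] := prime_avoidance hI S1.
- move=> _ _ [r [t [hr ht ->]]] [r' [t' [hr' ht' ->]]].
  exists (r * r'), (t * t'); split; first by case/(primeM hpp).
    by case/(primeM hP).
  by rewrite rmorphM mulrACA.
- move=> _ [r [t [hr ht ->]]] hrt; apply: ht; apply: IP => phi F hphi hF.
  have := hrt _ _ hphi hF; rewrite (induced_theta _ _ hphi hF) => /eqP.
  by rewrite mulf_eq0 => /orP[/eqP/hmu//|/eqP].
have P'P c : P' c -> P c.
  move=> hc; apply: contrapT => nc; apply: (SP' c) => //.
  by exists 1, c; rewrite rmorph1 mul1r; split=> //; exact: prime1.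
exists P'; split=> // [x|r]; split.
- by move=> /P'P /Pq.
- by move=> qx; apply: IP'; exact: kernel_ideal_q.
- move=> hr; apply: contrapT => nr; apply: (SP' (theta r)) => //.
  by exists r, 1; rewrite mulr1; split=> //; exact: prime1.
- by move=> hr; apply: IP'; apply: kernel_ideal_theta.
Qed.

(** If x is outside q, a functional with phi x = 1 sends 1 (x) x to 1. So the image of the
    complement of q misses the kernel ideal and can be avoided. *)
Lemma lying_over : exists P, [/\ is_prime P, forall x, P (j2 x) <-> q x
    & forall r, pp r -> P (theta r)].
Proof.
have [K [mu hmu]] := residue_field hpp.
pose I := kernel_ideal mu; have hI : is_ideal I by apply: kernel_ideal_ideal.
pose S c := exists x, ~ q x /\ c = j2 x.
have S1 : S 1 by exists 1; rewrite rmorph1; split=> //; exact: prime1.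
have [||P [hP [IP SP]]] := prime_avoidance hI S1.
- move=> _ _ [x [hx ->]] [x' [hx' ->]]; exists (x * x'); rewrite rmorphM; split=> //.
  by case/(primeM hq).
- move=> _ [x [hx ->]] hIx.
  have sq : saturated gy q.
    have hIq := prime_ideal hq.
    split; [exact: ideal0|by move=> *; apply: idealD|by move=> *; apply: ideal_mull|].
    by move=> l z l0 /(primeM hq)[/(gy_q l0)|].
  have nu_inj (l : L) : (mu \o emb) l = 0 -> l = 0 by move/hmu/pp_emb.
  have [phi [hD hM h0 h1]] := functional_extension nu_inj sq hx.
  have hphi : admissible mu phi by [].
  have [F hF] := induced_exists hphi.
  have [_ FE] := hF; have := hIx _ _ hphi hF.
  rewrite -[j2 x]mul1r -(rmorph1 j1) FE h1 mulr1 rmorph1 => /eqP.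
  by rewrite oner_eq0.
exists P; split=> // [x|r hr]; last by apply: IP; apply: kernel_ideal_theta.
split; last by move=> qx; apply: IP; exact: kernel_ideal_q.
by move=> hx; apply: contrapT => nx; apply: (SP (j2 x)) => //; exists x.
Qed.

End GoingDown.


(** * Algebraic dependence *)

Section Algebraicity.
Local Open Scope ring_scope.

Inductive gen (R : nzRingType) (T : R -> Prop) : R -> Prop :=
| gen_base x : T x -> gen T x
| gen_one : gen T 1
| gen_sub x y : gen T x -> gen T y -> gen T (x - y)
| gen_mul x y : gen T x -> gen T y -> gen T (x * y).

Section Gen.
Variables (R : nzRingType) (T : R -> Prop).
Lemma gen0 : gen T 0.
Proof. by rewrite -(subrr 1); apply: gen_sub; exact: gen_one. Qed.
Lemma gen_opp x : gen T x -> gen T (- x).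
Proof. by move=> h; rewrite -sub0r; apply: gen_sub => //; exact: gen0. Qed.
Lemma gen_add x y : gen T x -> gen T y -> gen T (x + y).
Proof. by move=> hx hy; rewrite -[y]opprK; apply: gen_sub => //; exact: gen_opp. Qed.
Lemma gen_exp x n : gen T x -> gen T (x ^+ n).
Proof.
by move=> h; elim: n => [|n IH]; rewrite ?expr0 ?exprS; [exact: gen_one|exact: gen_mul].
Qed.
Lemma gen_sum (I : Type) (r : seq I) (P : pred I) (F : I -> R) :
  (forall i, P i -> gen T (F i)) -> gen T (\sum_(i <- r | P i) F i).
Proof. by move=> h; apply: big_ind => //; [exact: gen0|exact: gen_add]. Qed.
End Gen.

Lemma gen_mono (R : nzRingType) (T T' : R -> Prop) :
  (forall x, T x -> gen T' x) -> forall x, gen T x -> gen T' x.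
Proof.
move=> h x; elim=> [z /h //||u v _ hu _ hv|u v _ hu _ hv]; first exact: gen_one.
  exact: gen_sub.
exact: gen_mul.
Qed.

Variable F : fieldType.
Implicit Types (T : F -> Prop).

(** The coefficients lie in the subring generated by [T], which suits lifting them to polynomial
    rings; [algP] passes to the generated subfield by clearing denominators. *)
Definition alg T y := exists p : {poly F}, [/\ p != 0, forall i, gen T p`_i & root p y].

Definition frac_gen T x := exists a b, [/\ gen T a, gen T b, b != 0 & x = a / b].
Definition frac_pred T : F -> bool := fun x => `[< frac_gen T x >].

Fact frac_pred_closed T : divring_closed (frac_pred T).
Proof.
split; first by apply/asboolP; exists 1, 1; rewrite oner_neq0 divr1; split=> //; exact: gen_one.
  move=> _ _ /asboolP[a [b [ha hb b0 ->]]] /asboolP[c [d [hc hd d0 ->]]].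
  apply/asboolP; exists (a * d - c * b), (b * d); split; last by field; rewrite b0 d0.
  - by apply: gen_sub; exact: gen_mul.
  - exact: gen_mul.
  - by rewrite mulf_neq0.
move=> _ _ /asboolP[a [b [ha hb b0 ->]]] /asboolP[c [d [hc hd d0 ->]]].
apply/asboolP; have [->|c0] := eqVneq c 0.
  by exists 0, 1; rewrite mul0r invr0 mulr0 oner_neq0 mul0r; split=> //; [exact: gen0|exact: gen_one].
exists (a * d), (b * c); split; last by field; rewrite b0 d0 c0.
- exact: gen_mul.
- exact: gen_mul.
- by rewrite mulf_neq0.
Qed.

HB.instance Definition _ T := GRing.isDivringClosed.Build F (frac_pred T) (frac_pred_closed T).

Definition frac_field T := {x : F | frac_pred T x}.
HB.instance Definition _ T := SubChoice.on (frac_field T).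
HB.instance Definition _ T := [SubChoice_isSubIntegralDomain of frac_field T by <:].
HB.instance Definition _ T := [SubIntegralDomain_isSubField of frac_field T by <:].

Definition frac_val T : {rmorphism frac_field T -> F} := (val : frac_field T -> F).

Lemma clear_denominators T (s : seq F) : (forall x, x \in s -> frac_gen T x) ->
  exists d, [/\ gen T d, d != 0 & forall x, x \in s -> gen T (d * x)].
Proof.
elim: s => [|x s IH] h; first by exists 1; rewrite oner_neq0; split=> //; exact: gen_one.
have [|d [hd d0 ds]] := IH; first by move=> z zs; apply: h; rewrite inE zs orbT.
have [a [b [ha hb b0 ex]]] := h x (mem_head _ _).
exists (d * b); split; [exact: gen_mul|by rewrite mulf_neq0|] => z; rewrite inE => /orP[/eqP->|zs].
  have -> : d * b * x = d * a by rewrite ex; field.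
  exact: gen_mul.
by rewrite mulrAC; apply: gen_mul => //; exact: ds.
Qed.

Lemma algP T y : alg T y <-> algebraicOver (frac_val T) y.
Proof.
split=> [[p [p0 hp rp]]|[p p0 rp]].
  have hf i : frac_pred T p`_i.
    by apply/asboolP; exists p`_i, 1; rewrite oner_neq0 divr1; split=> //; exact: gen_one.
  pose p' : {poly frac_field T} := \poly_(i < size p) (Sub _ (hf i)).
  have e : map_poly (frac_val T) p' = p.
    apply/polyP => i; rewrite coef_map coef_poly; case: ltnP => hi //.
    by rewrite [RHS]nth_default //; exact: (rmorph0 (frac_val T)).
  by exists p'; rewrite ?e //; apply: contra_neq p0 => e0; rewrite -e e0 rmorph0.
have [|d [hd d0 ds]] := @clear_denominators T (map_poly (frac_val T) p).
  move=> x /(nthP 0)[i _ <-]; rewrite coef_map /=.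
  by apply/asboolP; exact: (svalP p`_i).
exists (d *: map_poly (frac_val T) p); split.
- by rewrite scaler_eq0 negb_or d0 map_poly_eq0.
- move=> i; rewrite coefZ; case: (ltnP i (size (map_poly (frac_val T) p))) => hi.
    by apply: ds; exact: mem_nth.
  by rewrite nth_default // mulr0; exact: gen0.
- by rewrite rootE hornerZ (rootP rp) mulr0.
Qed.

Lemma alg_base T x : T x -> alg T x.
Proof.
move=> Tx; exists ('X - x%:P); split; rewrite ?polyXsubC_eq0 ?root_XsubC //.
move=> i; rewrite coefB coefX coefC; apply: gen_sub.
  by case: eqP => _; [exact: gen_one|exact: gen0].
by case: eqP => _; [exact: gen_base|exact: gen0].
Qed.

Lemma alg_gen T T' x : (forall z, T z -> alg T' z) -> gen T x -> alg T' x.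
Proof.
move=> h; elim=> [z /h //||u v _ /algP hu _ /algP hv|u v _ /algP hu _ /algP hv]; apply/algP.
- exact: algebraic1.
- exact: algebraic_sub.
- exact: algebraic_mul.
Qed.

Lemma alg_trans T T' y : (forall z, T z -> alg T' z) -> alg T y -> alg T' y.
Proof.
move=> h [p [p0 hp rp]]; apply/algP/integral_algebraic.
apply: (integral_root p0 rp) => _ /(nthP 0)[i _ <-].
by apply/integral_algebraic/algP; apply: alg_gen (hp i).
Qed.

Lemma alg_mono T T' y : (forall z, T z -> T' z) -> alg T y -> alg T' y.
Proof. by move=> h; apply: alg_trans => z /h; exact: alg_base. Qed.

Definition adjoin T x : F -> Prop := fun z => T z \/ z = x.

Lemma gen_adjoin T x z : gen (adjoin T x) z ->
  exists q : {poly F}, (forall i, gen T q`_i) /\ z = q.[x].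
Proof.
elim=> [u [Tu|->]||u v _ [p [hp ->]] _ [q [hq ->]]|u v _ [p [hp ->]] _ [q [hq ->]]].
- exists u%:P; rewrite hornerC; split=> // i; rewrite coefC.
  by case: eqP => _; [exact: gen_base|exact: gen0].
- exists 'X; rewrite hornerX; split=> // i; rewrite coefX.
  by case: eqP => _; [exact: gen_one|exact: gen0].
- exists 1; rewrite hornerC; split=> // i; rewrite coefC.
  by case: eqP => _; [exact: gen_one|exact: gen0].
- exists (p - q); rewrite hornerD hornerN; split=> // i; rewrite coefB.
  exact: gen_sub.
- exists (p * q); rewrite hornerM; split=> // i; rewrite coefM.
  by apply: gen_sum => j _; exact: gen_mul.
Qed.

Lemma nonalg_root T y (p : {poly F}) :
  ~ alg T y -> (forall i, gen T p`_i) -> root p y -> p = 0.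
Proof.
by move=> h hp rp; apply/eqP; apply: contrapT => /negP p0; apply: h; exists p.
Qed.

(** A relation for y over T and x is a polynomial in x and y. Reordered by powers of x it gives a
    relation for x, nonzero because y is transcendental over T. *)
Lemma alg_exchange T x y : alg (adjoin T x) y -> ~ alg T y -> alg (adjoin T y) x.
Proof.
move=> [p [p0 hp rp]] ny.
pose q i := projT1 (cid (gen_adjoin (hp i))).
have qT i j : gen T (q i)`_j by rewrite /q; case: cid => ? [].
have qx i : p`_i = (q i).[x] by rewrite /q; case: cid => ? [].
(* A common bound for the degrees in x makes the double sum rectangular. *)
pose M := \max_(i < size p) size (q i).
have hM i : (i < size p)%N -> (size (q i) <= M)%N.
  by move=> hi; exact: (@leq_bigmax _ (fun i : 'I_(size p) => size (q i)) (Ordinal hi)).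
pose r j := \poly_(i < size p) (q i)`_j.
have hr j i : gen T (r j)`_i.
  by rewrite coef_poly; case: ifP => _; [exact: qT|exact: gen0].
exists (\poly_(j < M) (r j).[y]); split.
- apply/eqP => e; move/eqP: p0; apply; apply/polyP => i; rewrite coef0 qx.
  case: (ltnP i (size p)) => hi; last first.
    by rewrite -qx nth_default.
  rewrite (horner_coef_wide _ (hM _ hi)) big1 // => j _.
  have : (r j).[y] = 0.
    by have := congr1 (fun s : {poly F} => s`_j) e; rewrite coef_poly ltn_ord coef0.
  move/rootP/(nonalg_root ny (hr j))/(congr1 (fun s : {poly F} => s`_i)).
  by rewrite coef_poly hi coef0 => ->; rewrite mul0r.
- move=> j; rewrite coef_poly; case: ifP => _; last exact: gen0.
  rewrite horner_coef; apply: gen_sum => i _; apply: gen_mul.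
    by apply: gen_mono (hr j i) => z Tz; apply: gen_base; left.
  by apply: gen_exp; apply: gen_base; right.
- rewrite rootE (@horner_coef_wide _ M) ?size_poly //.
  rewrite (eq_bigr (fun j : 'I_M => \sum_(i < size p) (q i)`_j * y ^+ i * x ^+ j)).
    have e := rootP rp; rewrite horner_coef in e.
    rewrite exchange_big /= -[X in _ == X]e; apply/eqP; apply: eq_bigr => i _.
    rewrite qx (horner_coef_wide _ (hM _ (ltn_ord i))) mulr_suml.
    by apply: eq_bigr => j _; rewrite mulrAC.
  move=> j _; rewrite coef_poly ltn_ord (horner_coef_wide _ (size_poly _ _)) mulr_suml.
  by apply: eq_bigr => i _; rewrite coef_poly ltn_ord.
Qed.

Definition with_seq T (s : seq F) : F -> Prop := fun z => T z \/ z \in s.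

Lemma exchange_seq T (s : seq F) y : alg (with_seq T s) y -> ~ alg T y ->
  exists s' : seq F, (size s').+1 = size s /\
    forall x, x \in s -> alg (with_seq (adjoin T y) s') x.
Proof.
elim: s => [|x s IH] hy ny.
  by case: ny; apply: alg_mono hy => z [].
case: (pselect (alg (with_seq T s) y)) => [hys|nys].
  have [s' [es hs']] := IH hys ny; exists (x :: s'); split=> [|z]; first by rewrite /= es.
  rewrite inE => /orP[/eqP->|/hs' hz]; first by apply: alg_base; right; rewrite mem_head.
  by apply: alg_mono hz => u [?|us]; [left|right; rewrite inE us orbT].
exists s; split=> // z; rewrite inE => /orP[/eqP->|zs]; last by apply: alg_base; right.
have : alg (adjoin (with_seq T s) y) x.
  apply: alg_exchange => //; apply: alg_mono hy => u [Tu|]; first by left; left.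
  by rewrite inE => /orP[/eqP ->|us]; [right|left; right].
by apply: alg_mono => u [[Tu|us]|->]; [left; left|right|left; right].
Qed.

Definition before T (c : nat -> F) n : F -> Prop :=
  fun z => T z \/ exists2 i, (i < n)%N & z = c i.

(** Algebraic independence in triangular form, which needs univariate polynomials only; [gindepP]
    identifies it with the multivariate form. *)
Definition free_seq T (c : nat -> F) n := forall j, (j < n)%N -> ~ alg (before T c j) (c j).

(** Exchange c_0 for one element of [s], move it into [T], and recurse on the shifted sequence. *)
Lemma steinitz n : forall T (c : nat -> F) s, free_seq T c n ->
  (forall j, (j < n)%N -> alg (with_seq T s) (c j)) -> (n <= size s)%N.
Proof.
elim: n => [//|n IH] T c s hfree halg.
have n0 : ~ alg T (c 0%N).
  by move=> h; apply: (hfree 0%N) => //; apply: alg_mono h => z; left.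
have [s' [<- hs']] := exchange_seq (halg 0%N isT) n0; rewrite ltnS.
apply: (IH (adjoin T (c 0%N)) (fun i => c i.+1)) => j jn.
  move=> h; apply: (hfree j.+1) => //; apply: alg_mono h => z [[Tz|->]|[i ij ->]].
  - by left.
  - by right; exists 0%N.
  - by right; exists i.+1.
apply: alg_trans (halg j.+1 jn) => z [Tz|zs]; last exact: hs'.
by apply: alg_base; left; left.
Qed.

End Algebraicity.


(** * Transcendence degree *)

Section Independence.
Local Open Scope ring_scope.

Definition img (R S : Type) (f : R -> S) : S -> Prop := fun z => exists r, z = f r.

Lemma gen_lift (R S : nzRingType) (h : {rmorphism R -> S}) (T : S -> Prop) (T' : R -> Prop) :
  (forall z, T z -> exists2 g, T' g & z = h g) ->
  forall z, gen T z -> exists2 g, gen T' g & z = h g.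
Proof.
move=> hT z; elim=> [u /hT[g hg ->]||u v _ [g hg ->] _ [g' hg' ->]|u v _ [g hg ->] _ [g' hg' ->]].
- by exists g => //; apply: gen_base.
- by exists 1; [exact: gen_one|rewrite rmorph1].
- by exists (g - g'); [exact: gen_sub|rewrite rmorphB].
- by exists (g * g'); [exact: gen_mul|rewrite rmorphM].
Qed.

Section EvalPoly.
Variables (R : comNzRingType) (n : nat) (j : 'I_n).
(** Isolating one variable reduces multivariate relations to the univariate notion [alg]. *)
Definition split_var : {mpoly R[n]} -> {poly {mpoly R[n]}} :=
  mmap (polyC \o @mpolyC n R) (fun i => if i == j then 'X else ('X_i)%:P).
HB.instance Definition _ := GRing.RMorphism.on split_var.

Lemma split_varC c : split_var c%:MP = c%:MP%:P. Proof. exact: mmapC. Qed.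
Lemma split_varX i : split_var 'X_i = if i == j then 'X else ('X_i)%:P.
Proof. exact: mmapX_id. Qed.

Lemma horner_split_var (t : {mpoly R[n]}) f :
  (split_var f).[t] = mmap (@mpolyC n R) (fun i => if i == j then t else 'X_i) f.
Proof.
pose H : {rmorphism _ -> _} := horner_eval t \o split_var.
apply: (@mpoly_hom_eq _ _ _ H (mmap (@mpolyC n R) (fun i => if i == j then t else 'X_i))) => [c|i] /=.
  by rewrite split_varC /horner_eval hornerC mmapC.
rewrite split_varX /horner_eval mmapX_id; case: ifP => _; first by rewrite hornerX.
by rewrite hornerC.
Qed.

Lemma horner_split_varX f : (split_var f).['X_j] = f.
Proof.
rewrite horner_split_var; apply: (@mpoly_hom_eq _ _ _ (mmap _ _) idfun) => [c|i] /=.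
  by rewrite mmapC.
by rewrite mmapX_id; case: eqP => [->|].
Qed.
End EvalPoly.

Section Specialize.
Variables (R S : comNzRingType) (io : {rmorphism R -> S}) (n : nat) (u : nat -> S).

(** All stages keep the same n variables, so that the primes obtained for successive m lie in one
    ring and form a chain. *)
Definition specialize (m : nat) : {mpoly R[n]} -> {mpoly S[n]} :=
  mmap (@mpolyC n S \o io) (fun i : 'I_n => if (i < m)%N then (u i)%:MP else 'X_i).
HB.instance Definition _ m := GRing.RMorphism.on (specialize m).

Lemma specializeC m c : specialize m c%:MP = (io c)%:MP.
Proof. exact: mmapC. Qed.

Lemma specializeX m (i : 'I_n) :
  specialize m 'X_i = if (i < m)%N then (u i)%:MP else 'X_i.
Proof. exact: mmapX_id. Qed.

Lemma specialize0 f : specialize 0 f = map_mpoly io f.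
Proof.
apply: (@mpoly_hom_eq _ _ _ (specialize 0) (map_mpoly io)) => [c|i] /=.
  by rewrite map_mpolyC specializeC.
by rewrite map_mpolyX_id specializeX.
Qed.

Lemma specializeS m (mn : (m < n)%N) f : specialize m.+1 f =
  mmap (@mpolyC n S) (fun i => if i == Ordinal mn then (u m)%:MP else 'X_i) (specialize m f).
Proof.
pose H : {rmorphism _ -> _} :=
  mmap (@mpolyC n S) (fun i => if i == Ordinal mn then (u m)%:MP else 'X_i) \o specialize m.
apply: (@mpoly_hom_eq _ _ _ (specialize m.+1) H) => [c|i] /=.
  by rewrite !specializeC mmapC.
rewrite !specializeX [in LHS]ltnS [in LHS]leq_eqVlt.
case: (ltnP i m) => hi; first by rewrite orbT mmapC.
by rewrite orbF mmapX_id -val_eqE /=; case: eqP => // ->.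
Qed.

Lemma specialize_all f : specialize n f = (mmap io (fun i : 'I_n => u i) f)%:MP.
Proof.
rewrite rmorph_mmap; apply: (@mpoly_hom_eq _ _ _ (specialize n) (mmap _ _)) => [c|i] /=.
  by rewrite specializeC mmapC.
by rewrite specializeX mmapX_id ltn_ord.
Qed.
End Specialize.

Section SpecializeInj.
Variables (R : comNzRingType) (F : fieldType) (io : {rmorphism R -> F}).
Variables (n : nat) (u : nat -> F).
Local Notation specialize := (@specialize R F io n u).

(** Undo one substitution at a time: before u_m is substituted, all coefficients lie in the ring
    generated by R and u_0, ..., u_(m-1), over which u_m is transcendental. *)
Lemma specialize_inj m f : (m <= n)%N -> free_seq (img io) u m ->
  specialize m f = 0 -> forall mon, io f@_mon = 0.
Proof.
elim: m f => [|m IH] f mn hfree h0.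
  move=> mon; rewrite -mcoeff_map_mpoly.
  by rewrite -(@specialize0 _ _ io n u) h0 mcoeff0.
apply: IH; [exact: ltnW|by move=> j hj; apply: hfree; rewrite ltnS ltnW|].
pose j := Ordinal mn; set G := gen (before (img io) u m).
pose psi : {rmorphism _ -> _} := split_var j \o specialize m.
have hpsi : forall g l mon, G ((psi g)`_l)@_mon.
  have G0 : G 0 by exact: gen0.
  have G1 : G 1 by exact: gen_one.
  apply: mpoly_gen_ind => [c|i|p q hp hq|p q hp hq] l mon.
  - have -> : psi c%:MP = (io c)%:MP%:P by rewrite /= specializeC split_varC.
    rewrite coefC; case: ifP => _; last by rewrite mcoeff0.
    rewrite mcoeffC; apply: gen_mul; last by case: eqP.
    by apply: gen_base; left; exists c.
  - rewrite /= specializeX; case: ltnP => hi.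
      rewrite split_varC coefC; case: eqP => _; last by rewrite mcoeff0.
      rewrite mcoeffC; apply: gen_mul; last by case: eqP.
      by apply: gen_base; right; exists i.
    rewrite split_varX; case: eqP => _.
      rewrite coefX; case: eqP => _ /=; last by rewrite mulr0n mcoeff0.
      by rewrite mulr1n mcoeff1; case: (mon == 0%MM).
    rewrite coefC; case: ifP => _; last by rewrite mcoeff0.
    by rewrite mcoeffX; case: (_ == _).
  - by rewrite rmorphD coefD mcoeffD; apply: gen_add; [exact: hp|exact: hq].
  - rewrite rmorphM coefM raddf_sum; apply: gen_sum => i _ /=.
    by rewrite mcoeffM; apply: gen_sum => -[k1 k2] _ /=; apply: gen_mul; [exact: hp|exact: hq].
rewrite -[LHS](horner_split_varX j).
suff -> : split_var j (specialize m f) = 0 by rewrite horner0.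
have e : (split_var j (specialize m f)).[(u m)%:MP] = 0.
  by rewrite -[RHS]h0 horner_split_var (specializeS _ _ mn).
apply/polyP => l; apply/mpolyP => mon; rewrite coef0 mcoeff0.
set p := split_var j _ in e *.
(* For a fixed monomial the coefficients form a univariate polynomial over [G] vanishing at u_m. *)
have : \poly_(i < size p) (p`_i)@_mon = 0.
  apply: (nonalg_root (hfree m _)) => // [i|].
    by rewrite coef_poly; case: ifP => _; [exact: hpsi|exact: gen0].
  rewrite rootE (horner_coef_wide _ (size_poly _ _)).
  have := congr1 (fun g : {mpoly F[n]} => g@_mon) e.
  rewrite mcoeff0 horner_coef raddf_sum /= => e'; rewrite -[X in _ == X]e'.
  apply/eqP; apply: eq_bigr => i _.
  by rewrite coef_poly ltn_ord -rmorphXn mulrC -mcoeffCM mulrC.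
move/(congr1 (fun g : {poly F} => g`_l)); rewrite coef_poly coef0.
by case: ltnP => // hl _; rewrite nth_default // mcoeff0.
Qed.

Lemma mmap_inj f : free_seq (img io) u n ->
  mmap io (fun i : 'I_n => u i) f = 0 -> forall mon, io f@_mon = 0.
Proof.
move=> hfree h0; apply: (specialize_inj (leqnn n) hfree).
by rewrite specialize_all h0.
Qed.
End SpecializeInj.

(** The coefficients of a relation for x_j lift to polynomials in the variables before j; with
    powers of ['X_j] they assemble to a polynomial killed by evaluation, and splitting off ['X_j]
    recovers each of them. *)
Lemma indep_free (k F : fieldType) (io : {rmorphism k -> F}) n (x : nat -> F) :
  (forall f : {mpoly k[n]}, mmap io (fun i : 'I_n => x i) f = 0 -> f = 0) ->
  free_seq (img io) x n.
Proof.
move=> hx j jn [p [p0 hp rp]]; pose jo := Ordinal jn.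
pose ev : {rmorphism {mpoly k[n]} -> F} := mmap io (fun i : 'I_n => x i).
pose T' (f : {mpoly k[n]}) := (exists c, f = c%:MP) \/ exists2 i : 'I_n, (i < j)%N & f = 'X_i.
have hlift z : gen (before (img io) x j) z -> exists2 g, gen T' g & z = ev g.
  apply: gen_lift => _ [[c ->]|[i ij ->]].
    by exists c%:MP; [left; exists c|rewrite /ev /= mmapC].
  exists 'X_(Ordinal (ltn_trans ij jn)); last by rewrite /ev /= mmapX_id.
  by right; exists (Ordinal (ltn_trans ij jn)).
have hT g : gen T' g -> split_var jo g = g%:P.
  elim=> [_ [[c ->]|[i ij ->]]||u v _ hu _ hv|u v _ hu _ hv].
  - exact: split_varC.
  - by rewrite split_varX -val_eqE /= ltn_eqF.
  - exact: rmorph1.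
  - by rewrite rmorphB /= hu hv polyCB.
  - by rewrite rmorphM /= hu hv polyCM.
pose g l := projT1 (cid2 (hlift _ (hp l))).
have gT l : gen T' (g l) by rewrite /g; case: cid2.
have ge l : p`_l = ev (g l) by rewrite /g; case: cid2.
pose f := \sum_(l < size p) g l * 'X_jo ^+ l.
have f0 : f = 0.
  apply: hx; rewrite -/ev -/(ev f) /f rmorph_sum -[RHS](rootP rp) horner_coef.
  apply: eq_bigr => l _; rewrite rmorphM rmorphXn -ge; congr (_ * _ ^+ _).
  exact: mmapX_id.
have : split_var jo f = \poly_(l < size p) g l.
  rewrite /f rmorph_sum poly_def; apply: eq_bigr => l _.
  rewrite rmorphM rmorphXn /= hT // split_varX eqxx mul_polyC //.
rewrite f0 rmorph0 => e; move/eqP: p0; apply; apply/polyP => l; rewrite coef0 ge.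
have := congr1 (fun q : {poly {mpoly k[n]}} => q`_l) e; rewrite coef0 coef_poly.
case: ltnP => hl; first by move=> <-; rewrite rmorph0.
by rewrite -ge nth_default.
Qed.

(* Transcendence degree for rings such as {mpoly R[n]}, whose k-algebra
   structure is not a canonical instance; in_alg A gives back td_mod. *)
Definition gindep (k : fieldType) (A : comNzRingType) (io : {rmorphism k -> A})
    (P : A -> Prop) (n : nat) (x : 'I_n -> A) : Prop :=
  forall f : {mpoly k[n]}, f != 0 -> ~ P (mmap io x f).

Definition gtd (k : fieldType) (A : comNzRingType) (io : {rmorphism k -> A})
    (P : A -> Prop) : nat := natsup (fun n => exists x : 'I_n -> A, gindep io P x).

Definition bounded_td (k : fieldType) (A : comNzRingType) (io : {rmorphism k -> A})
    (P : A -> Prop) (b : nat) := forall n (x : 'I_n -> A), gindep io P x -> (n <= b)%N.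

Section Td.
Variables (k : fieldType) (A : comNzRingType) (io : {rmorphism k -> A}).
Implicit Types (P Q : A -> Prop).

(** Families indexed by [nat] are shortened and extended without casts; 0 fills the places from n
    on. *)
Definition seq_of n (x : 'I_n -> A) : nat -> A := fun i => oapp x 0 (insub i).
Lemma seq_ofE n (x : 'I_n -> A) : (fun i : 'I_n => seq_of x i) = x.
Proof. by apply/funext => i; rewrite /seq_of valK. Qed.

Section Field.
Variables (P : A -> Prop) (F : fieldType) (pi : {rmorphism A -> F}).
Hypothesis hpi : forall a, pi a = 0 <-> P a.

Lemma gindepP n (x : nat -> A) :
  gindep io P (fun i : 'I_n => x i) <-> free_seq (img (pi \o io)) (pi \o x) n.
Proof.
split=> h.
  apply: indep_free => f hf; apply/eqP; apply: contrapT => /negP f0.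
  apply: (h f f0); apply/hpi; rewrite rmorph_mmap; exact: hf.
move=> f f0 /hpi; rewrite rmorph_mmap => hf; move/eqP: f0; apply.
apply/mpolyP => mon; rewrite mcoeff0.
have /eqP := mmap_inj h hf mon.
by rewrite (fmorph_eq0 (pi \o io)) => /eqP.
Qed.

Lemma gindep_bound (s : seq F) :
  (forall a, alg (with_seq (img (pi \o io)) s) (pi a)) -> bounded_td io P (size s).
Proof.
move=> h n x; rewrite -(seq_ofE x) => /gindepP hx.
by apply: steinitz hx _ => j _; exact: h.
Qed.

Lemma basis_alg n (x : nat -> A) : gindep io P (fun i : 'I_n => x i) ->
  (forall y : 'I_n.+1 -> A, ~ gindep io P y) ->
  forall a, alg (with_seq (img (pi \o io)) (mkseq (pi \o x) n)) (pi a).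
Proof.
move=> /gindepP hx hmax a; apply: contrapT => na.
apply: (hmax (fun i : 'I_n.+1 => if (i < n)%N then x i else a)).
apply/(gindepP _ (fun i => if (i < n)%N then x i else a)) => j; rewrite ltnS leq_eqVlt.
case/orP => [/eqP ->|jn] /=; last first.
  rewrite jn => h; apply: (hx j jn); apply: alg_mono h => z [Tz|[i ij ->]]; first by left.
  by right; exists i => //=; rewrite (ltn_trans ij jn).
rewrite ltnn => h; apply: na; apply: alg_mono h => z [Tz|[i ij ->]]; first by left.
by right; apply/mapP; exists i; rewrite ?mem_iota //= ij.
Qed.
End Field.

Lemma gindep0 P : is_prime P -> gindep io P (fun i : 'I_0 => 0).
Proof.
move=> hP f f0 hf; apply: (prime1 hP).
have ef : f = (f@_0%MM)%:MP.
  by apply/mpolyP => m; rewrite mcoeffC nvar0_mnmE eqxx mulr1.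
have c0 : f@_0%MM != 0 by apply: contra_neq f0 => e; rewrite ef e.
move: hf; rewrite ef mmapC => hf.
rewrite -(rmorph1 io) -(mulVf c0) rmorphM; apply: ideal_mull => //; exact: prime_ideal.
Qed.

Lemma gtdP P b : is_prime P -> bounded_td io P b ->
  (exists x : nat -> A, gindep io P (fun i : 'I_(gtd io P) => x i)) /\
  bounded_td io P (gtd io P).
Proof.
move=> hP hb; have [||[x hx] hmax] := @natsupP (fun n => exists x : 'I_n -> A, gindep io P x) b.
- by exists 0%N, (fun=> 0); exact: gindep0.
- by move=> n [x /hb].
split; last by move=> n y hy; apply: hmax; exists y.
by exists (seq_of x); rewrite seq_ofE.
Qed.

Lemma gtd_basis P b : is_prime P -> bounded_td io P b ->
  exists x : nat -> A, gindep io P (fun i : 'I_(gtd io P) => x i) /\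
  forall (F : fieldType) (pi : {rmorphism A -> F}), (forall a, pi a = 0 <-> P a) ->
  forall a, alg (with_seq (img (pi \o io)) (mkseq (pi \o x) (gtd io P))) (pi a).
Proof.
move=> hP hb; have [[x hx] hmax] := gtdP hP hb; exists x; split=> // F pi hpi.
by apply: basis_alg => // y /hmax; rewrite ltnn.
Qed.

Lemma gtd_le P b : is_prime P -> bounded_td io P b -> (gtd io P <= b)%N.
Proof. by move=> hP hb; have [[x hx] _] := gtdP hP hb; exact: hb hx. Qed.

Lemma gtd_ge P b n (x : 'I_n -> A) : is_prime P -> bounded_td io P b -> gindep io P x ->
  (n <= gtd io P)%N.
Proof. by move=> hP hb hx; have [_ h] := gtdP hP hb; exact: h hx. Qed.

Lemma gindep_sub P Q n (x : 'I_n -> A) : (forall a, P a -> Q a) ->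
  gindep io Q x -> gindep io P x.
Proof. by move=> h hx f f0 /h; exact: hx. Qed.

Lemma bounded_td_sub P Q b : (forall a, P a -> Q a) -> bounded_td io P b -> bounded_td io Q b.
Proof. by move=> h hb n x hx; apply: hb (gindep_sub h hx). Qed.

Lemma gindep_prefix P n m (x : nat -> A) : is_prime P -> (m <= n)%N ->
  gindep io P (fun i : 'I_n => x i) -> gindep io P (fun i : 'I_m => x i).
Proof.
move=> hP mn; have [F [pi hpi]] := residue_field hP.
move=> /(gindepP hpi) h; apply/(gindepP hpi) => j jm; apply: h.
exact: leq_trans jm mn.
Qed.

(* An element of Q outside P is transcendental mod P over any family
   independent mod Q: reduce a relation of least order mod Q. *)
Lemma gindep_drop P Q n (x : 'I_n -> A) : is_prime P -> is_prime Q ->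
  (forall a, P a -> Q a) -> (exists a, Q a /\ ~ P a) -> gindep io Q x ->
  exists y : 'I_n.+1 -> A, gindep io P y.
Proof.
move=> hP hQ PQ [a [Qa nPa]] hx; have [F [pi hpi]] := residue_field hP.
move: hx; rewrite -(seq_ofE x); move: (seq_of x) => {}x hx.
have /(gindepP hpi) hfree := gindep_sub PQ hx.
exists (fun i : 'I_n.+1 => if (i < n)%N then x i else a).
apply/(gindepP hpi _ (fun i => if (i < n)%N then x i else a)) => j; rewrite ltnS leq_eqVlt.
case/orP => [/eqP ->|jn] /=; last first.
  rewrite jn => h; apply: (hfree j jn); apply: alg_mono h => z [Tz|[i ij ->]]; first by left.
  by right; exists i => //=; rewrite (ltn_trans ij jn).
rewrite ltnn => -[p [p0 hp rp]].
pose ev : {rmorphism {mpoly k[n]} -> A} := mmap io (fun i : 'I_n => x i).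
have hlift z : gen (before (img (pi \o io)) (pi \o (fun i => if (i < n)%N then x i else a)) n) z ->
    exists g, z = pi (ev g).
  move=> hz; have [|g _ ->] := @gen_lift _ _ (pi \o ev) _ (fun=> True) _ z hz; last by exists g.
  move=> _ [[c ->]|[i ij ->]].
    by exists c%:MP; rewrite //= mmapC.
  by exists 'X_(Ordinal ij); rewrite //= ij mmapX_id.
(* Since [pi a] is nonzero, the power of the variable dividing [p] can be cancelled, leaving a
   relation with nonzero constant term. *)
have ex : exists e, p`_e != 0.
  by exists (size p).-1; rewrite -lead_coefE lead_coef_eq0.
have [e pe emin] := ex_minnP ex.
pose q := drop_poly e p.
have pq : p = q * 'X^e.
  rewrite -[LHS](poly_take_drop e) -/q [X in X + _](_ : _ = 0) ?add0r //.
  apply/polyP => i; rewrite coef_take_poly coef0; case: ltnP => // ie.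
  by apply/eqP; apply: contrapT => /negP /emin; rewrite leqNgt ie.
have pia : pi a != 0 by apply/eqP => /hpi.
have rq : root q (pi a).
  move: rp; rewrite pq rootM rootE [root 'X^e _]rootE hornerXn expf_eq0 (negbTE pia) andbF orbF //.
have hq l : exists g, q`_l = pi (ev g).
  by have [g eg] := hlift _ (hp (l + e)%N); exists g; rewrite coef_drop_poly.
pose g l := projT1 (cid (hq l)); have ge l : q`_l = pi (ev (g l)) by rewrite /g; case: cid.
have hs : P (\sum_(l < size q) ev (g l) * a ^+ l).
  apply/hpi; rewrite rmorph_sum -[RHS](rootP rq) horner_coef; apply: eq_bigr => l _.
  by rewrite rmorphM rmorphXn ge.
have q0 : q`_0 != 0 by rewrite coef_drop_poly.
have sq : (0 < size q)%N.
  by rewrite lt0n; apply: contra_neq q0 => s0; rewrite nth_default ?s0.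
have Qg : Q (ev (g 0%N)).
  have hQI := prime_ideal hQ.
  have := PQ _ hs; rewrite -(prednK sq) big_ord_recl expr0 mulr1 => h.
  set w := \sum_(i < _) _ in h; rewrite -[ev _](addrK w); apply: idealB => //.
  by apply: ideal_sum => // i _; rewrite exprS mulrCA; exact: ideal_mulr.
apply: (hx (g 0%N)) => //; apply: contra_neq q0 => g0.
by rewrite ge g0 !rmorph0.
Qed.

Lemma gtd_drop P Q b : is_prime P -> is_prime Q -> (forall a, P a -> Q a) ->
  (exists a, Q a /\ ~ P a) -> bounded_td io P b -> (gtd io Q < gtd io P)%N.
Proof.
move=> hP hQ PQ ne hb; have hbQ := bounded_td_sub PQ hb.
have [[x hx] _] := gtdP hQ hbQ.
have [y hy] := gindep_drop hP hQ PQ ne hx.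
exact: gtd_ge hb hy.
Qed.

End Td.
End Independence.


(** * Chains of primes *)

Section Chains.
Variable A : comNzRingType.
Implicit Types (P Q : A -> Prop).

(** In contrast to [prime_chain], both ends are visible, as gluing requires. *)
Inductive chain : nat -> (A -> Prop) -> (A -> Prop) -> Prop :=
| chain0 P : is_prime P -> chain 0 P P
| chainS n P Q Q' : chain n P Q -> is_prime Q' -> (forall x, Q x -> Q' x) ->
    (exists x, Q' x /\ ~ Q x) -> chain n.+1 P Q'.

Lemma chain_bot n P Q : chain n P Q -> is_prime P.
Proof. by elim. Qed.
Lemma chain_top n P Q : chain n P Q -> is_prime Q.
Proof. by case. Qed.
Lemma chain_sub n P Q : chain n P Q -> forall x, P x -> Q x.
Proof. by elim=> // m P' Q1 Q2 _ h _ h' _ x /h /h'. Qed.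

Lemma chain_of_prime_chain c n : prime_chain c n -> chain n (c 0%N) (c n).
Proof.
elim: n => [|n IH] [hp hs]; first by apply: chain0; apply: hp.
have [h1 h2] := hs n (ltnSn n); apply: chainS (IH _) _ h1 h2; last exact: hp.
by split=> i hi; [apply: hp; exact: ltnW|apply: hs; rewrite ltnS ltnW].
Qed.

Lemma prime_chain_of_chain n P Q : chain n P Q ->
  exists c, [/\ prime_chain c n, c 0%N = P & c n = Q].
Proof.
elim=> [R hR|m R S S' hc [c [[hp hs] c0 cm]] hS' sub ne].
  by exists (fun=> R); split.
exists (fun i => if i <= m then c i else S'); rewrite ltnn leq0n; split=> //.
split=> i hi; first by case: ifP => // /hp.
have [->|im] : i = m \/ i < m by lia.
  by rewrite leqnn ltnn cm.
by rewrite /= im (ltnW im); apply: hs.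
Qed.

(** [Q] takes the place of [Q0], so they may coincide or differ. For m = 0 the new top is [Q], hence
    only contained in [S]. *)
Lemma chain_glue n m P Q Q0 S : chain n P Q -> (forall x, Q x -> Q0 x) -> chain m Q0 S ->
  exists E, chain (n + m) P E /\ forall x, E x -> S x.
Proof.
move=> hPQ sub hc; elim: hc sub => [R hR|{}m R S1 S2 _ IH hS2 sub12 [x [Sx nx]]] sub.
  by exists Q; rewrite addn0.
have [E [hE ES]] := IH sub; exists S2; split=> //; rewrite addnS.
apply: chainS hE hS2 _ _; first by move=> z /ES /sub12.
by exists x; split=> // /ES.
Qed.

Definition dim_le (b : nat) := forall n P Q, chain n P Q -> n <= b.

Lemma kdim_ge b n P Q : dim_le b -> chain n P Q -> n <= kdim A.
Proof.
move=> hb hc; apply: (@natsup_ge _ b); last first.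
  by have [c [h _ _]] := prime_chain_of_chain hc; exists c.
by move=> i [c] /chain_of_prime_chain; exact: hb.
Qed.

Lemma kdim_attained b P : dim_le b -> is_prime P ->
  (exists Q Q', chain (kdim A) Q Q').
Proof.
move=> hb hP.
have [||[c hc] _] := @natsupP (fun n => exists c : nat -> A -> Prop, prime_chain c n) b.
- by exists 0, (fun=> P); split.
- by move=> i [c] /chain_of_prime_chain; exact: hb.
by exists (c 0), (c (kdim A)); exact: chain_of_prime_chain.
Qed.

Lemma height_ge b n P0 P : dim_le b -> chain n P0 P -> n <= height P.
Proof.
move=> hb hc; apply: (@natsup_ge _ b).
  by move=> i [c [/chain_of_prime_chain hi _]]; exact: hb hi.
by have [c [h _ e]] := prime_chain_of_chain hc; exists c; rewrite e.
Qed.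

Lemma height_attained b P : dim_le b -> is_prime P -> exists P0, chain (height P) P0 P.
Proof.
move=> hb hP.
have [||[c [hc e]] _] := @natsupP (fun n => exists c : nat -> A -> Prop,
   prime_chain c n /\ forall x, c n x <-> P x) b.
- by exists 0, (fun=> P); split.
- by move=> i [c [/chain_of_prime_chain hi _]]; exact: hb hi.
exists (c 0); have eP : c (height P) = P by apply: subset_eq => x /e.
by rewrite -[X in chain _ _ X]eP; exact: chain_of_prime_chain.
Qed.

Lemma height_le_kdim b P : dim_le b -> is_prime P -> height P <= kdim A.
Proof.
by move=> hb hP; have [P0 h] := height_attained hb hP; exact: kdim_ge hb h.
Qed.

Lemma height_lt b P Q : dim_le b -> is_prime P -> is_prime Q -> (forall x, P x -> Q x) ->
  (exists x, Q x /\ ~ P x) -> height P < height Q.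
Proof.
move=> hb hP hQ sub ne; have [P0 h] := height_attained hb hP.
exact: height_ge hb (chainS h hQ sub ne).
Qed.

Section ChainTd.
Variables (k : fieldType) (io : {rmorphism k -> A}).

Lemma chain_td b n P Q : bounded_td io P b -> chain n P Q -> gtd io Q + n <= gtd io P.
Proof.
move=> hb hc; elim: hc hb => [R hR hb|m R S S' hc IH hS' sub ne hb]; first by rewrite addn0.
apply: leq_trans (IH hb); rewrite addnS -addSn leq_add2r.
apply: gtd_drop (chain_top hc) hS' sub ne _.
by apply: bounded_td_sub hb; exact: chain_sub hc.
Qed.

Lemma dim_le_td b : bounded_td io (fun a => a = 0%R) b -> dim_le b.
Proof.
move=> hb n P Q hc; have hP := chain_bot hc.
have hbP : bounded_td io P b.
  by apply: bounded_td_sub hb => a ->; apply: ideal0; exact: prime_ideal.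
have := chain_td hbP hc; have := gtd_le hP hbP; lia.
Qed.
End ChainTd.
End Chains.

(** * Transcendence degree in tensor products and polynomial rings *)

Section AlgebraTd.
Local Open Scope ring_scope.
Variables (k : fieldType).

Lemma gindep_comp (A B : comAlgType k) (f : {rmorphism A -> B}) (P : B -> Prop) n (x : 'I_n -> A) :
  (forall c : k, f c%:A = c%:A) ->
  gindep (in_alg A) (fun a => P (f a)) x <-> gindep (in_alg B) P (f \o x).
Proof.
move=> hf; have e g : f (mmap (in_alg A) x g) = mmap (in_alg B) (f \o x) g.
  by rewrite rmorph_mmap; apply: eq_mmap => // c; exact: hf.
by split=> h g /h; rewrite e.
Qed.

Lemma td_mod_comp_le (A B : comAlgType k) (f : {rmorphism A -> B}) (P : B -> Prop) b :
  (forall c : k, f c%:A = c%:A) -> is_prime P -> bounded_td (in_alg B) P b ->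
  bounded_td (in_alg A) (fun a => P (f a)) (td_mod P).
Proof.
by move=> hf hP hb n x /(gindep_comp _ _ hf) h; exact: gtd_ge hb h.
Qed.

Section TensorTd.
Variables (A B C : comAlgType k) (j1 : {rmorphism A -> C}) (j2 : {rmorphism B -> C}).
Hypothesis hC : is_tensor j1 j2.

Lemma tensor_scalar1 (c : k) : j1 c%:A = c%:A.
Proof. by have [[_ [_ [e z]]] _] := hC; rewrite z e. Qed.
Lemma tensor_scalar2 (c : k) : j2 c%:A = c%:A.
Proof. by have [_ [[_ [_ [e z]]] _]] := hC; rewrite z e. Qed.

(** Every simple tensor is algebraic over the union of transcendence bases for the two
    contractions. *)
Lemma tensor_td_le (P : C -> Prop) a b : is_prime P ->
  bounded_td (in_alg A) (fun x => P (j1 x)) a -> bounded_td (in_alg B) (fun x => P (j2 x)) b ->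
  bounded_td (in_alg C) P (td_mod (fun x => P (j1 x)) + td_mod (fun x => P (j2 x))).
Proof.
move=> hP ha hb; have [F [pi hpi]] := residue_field hP.
have [x [_ hx]] := gtd_basis (prime_preim j1 hP) ha.
have [y [_ hy]] := gtd_basis (prime_preim j2 hP) hb.
pose s1 := mkseq ((pi \o j1) \o x) (td_mod (fun x => P (j1 x))).
pose s2 := mkseq ((pi \o j2) \o y) (td_mod (fun x => P (j2 x))).
have hs : size (s1 ++ s2) = (td_mod (fun x => P (j1 x)) + td_mod (fun x => P (j2 x)))%N.
  by rewrite size_cat !size_mkseq.
rewrite -hs; apply: (gindep_bound hpi) => c.
apply: (@alg_gen _ (fun z => (exists u, z = pi (j1 u)) \/ (exists u, z = pi (j2 u)))).
  move=> _ [[u ->]|[u ->]].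
    apply: alg_mono (hx _ (pi \o j1) (fun a => hpi (j1 a)) u) => z [[r ->]|zs].
      by left; exists r; rewrite /= tensor_scalar1.
    by right; rewrite mem_cat zs.
  apply: alg_mono (hy _ (pi \o j2) (fun a => hpi (j2 a)) u) => z [[r ->]|zs].
    by left; exists r; rewrite /= tensor_scalar2.
  by right; rewrite mem_cat zs orbT.
have [s ->] := tensor_gen hC c; rewrite rmorph_sum; apply: gen_sum => p _.
rewrite rmorphM; apply: gen_mul; apply: gen_base; first by left; exists p.1.
by right; exists p.2.
Qed.
End TensorTd.

Lemma mpoly_bounded_td (A : comAlgType k) n b : is_domain A ->
  bounded_td (in_alg A) (fun a => a = 0) b ->
  bounded_td (@mpolyC n A \o in_alg A) (fun a => a = 0) (b + n).
Proof.
move=> dom hb; pose Z (a : A) := a = 0; have hZ := zero_prime dom.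
have [x [_ hx]] := gtd_basis hZ hb.
have hE := ext_prime n hZ; have [F [pi hpi]] := residue_field hE.
have hpiC a : (pi \o @mpolyC n A) a = 0 <-> Z a.
  by rewrite /= hpi ext_ideal_mpolyC //; exact: prime_ideal.
set t := gtd _ _ in x hx.
pose s := mkseq ((pi \o @mpolyC n A) \o x) t ++ [seq pi 'X_i | i <- enum 'I_n].
have hs : (size s <= b + n)%N.
  by rewrite size_cat size_mkseq size_map size_enum_ord leq_add2r; exact: gtd_le hb.
move=> m y hy; apply: leq_trans hs.
have hE0 f : ext_ideal n Z f -> f = 0.
  by move=> h; apply/mpolyP => mon; rewrite mcoeff0; exact: h.
apply: (gindep_bound hpi) (gindep_sub hE0 hy) => f.
elim/mpoly_gen_ind: f => [c|i|p q /algP hp /algP hq|p q /algP hp /algP hq].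
- apply: alg_mono (hx _ (pi \o @mpolyC n A) hpiC c) => z [[r ->]|zs].
    by left; exists r.
  by right; rewrite mem_cat zs.
- apply: alg_base; right; rewrite mem_cat; apply/orP; right; apply/mapP.
  by exists i; rewrite ?mem_enum.
- by rewrite rmorphD; apply/algP; exact: algebraic_add.
- by rewrite rmorphM; apply/algP; exact: algebraic_mul.
Qed.

End AlgebraTd.


(** * The upper bound *)

Section Profile.
Variable k : fieldType.

Definition contains (A : Type) (M p : A -> Prop) := forall x, M x -> p x.

(* What the dimension formula needs to know about a pullback R: t = t.d. R,
   h = ht M in T, s = t.d. D, d = dim D, and e = t - h - s is the transcendence
   degree of K over D (0 if M = 0). *)
Record profile (R : comAlgType k) (M : R -> Prop) (t h s d e : nat) : Prop := Profile {
  pr_dom : is_domain R;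
  pr_prime : is_prime M;
  pr_sum : t = h + s + e;
  pr_bound : bounded_td (in_alg R) (fun a => a = 0%R) t;
  pr_above : forall p : R -> Prop, is_prime p -> contains M p -> td_mod p <= s <= td_mod p + d;
  pr_not : forall p : R -> Prop, is_prime p -> ~ contains M p -> t <= td_mod p + h;
  pr_below : forall p p' : R -> Prop, is_prime p -> is_prime p' -> contains p p' -> contains M p' ->
    ~ contains M p -> t < td_mod p + h;
  pr_chain : forall n, exists P0, chain (h + minn n e) P0 (ext_ideal n M);
  pr_top : exists m : R -> Prop, chain d M m /\ td_mod m + d = s }.

(* Read a i, b i, tau i as the transcendence degrees of the residue rings of the
   i-th prime of a chain in the tensor product and of its two contractions. *)
Section ChainNumbers.
Variables (n : nat) (a b tau : nat -> nat).
Hypothesis tau_drop : forall i j, i <= j <= n -> tau j + (j - i) <= tau i.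
Hypothesis tau_a : forall i, i <= n -> a i <= tau i.
Hypothesis tau_b : forall i, i <= n -> b i <= tau i.
Hypothesis tau_ab : forall i, i <= n -> tau i <= a i + b i.
Variables (t1 h1 s1 d1 e1 t2 h2 s2 d2 e2 : nat).
Hypothesis t1E : t1 = h1 + s1 + e1.
Hypothesis t2E : t2 = h2 + s2 + e2.
Hypothesis a_le : forall i, i <= n -> a i <= t1.
Hypothesis b_le : forall i, i <= n -> b i <= t2.

(** [delta] is the dimension of D1 (x) D2. [V1] counts a route reaching M1 first and [V2] one
    reaching M2 first: the terms stand for the heights of the extended maximal ideals met on the
    way. *)
Let delta := minn (s1 + d2) (d1 + s2).
Let V1 := h1 + minn t2 e1 + (h2 + minn s1 e2 + delta).
Let V2 := h2 + minn t1 e2 + (h1 + minn s2 e1 + delta).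

Let tau_n : n + tau n <= tau 0.
Proof. by have := tau_drop (i := 0) (j := n) (leqnn _); lia. Qed.
Let tau_0 : tau 0 <= t1 + t2.
Proof. by have := tau_ab (leq0n n); have := a_le (leq0n n); have := b_le (leq0n n); lia. Qed.
(** Used at the first index where a contraction contains M; the strict inequality [pr_below] at the
    preceding index absorbs the extra 1. *)
Let tau_pred i : 0 < i <= n -> i + tau i.-1 <= (t1 + t2).+1.
Proof.
move=> hi; have hi1 : i.-1 <= n by lia.
by have := tau_drop (i := 0) (j := i.-1); rewrite hi1 => /(_ isT); lia.
Qed.

(** The case where the top prime contracts to primes containing neither M1 nor M2. *)
Lemma numbers_neither : t1 <= a n + h1 -> t2 <= b n + h2 -> n <= maxn V1 V2.
Proof.
move=> ha hb; have := tau_a (leqnn n); have := tau_b (leqnn n) => hb' ha'.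
have l1 : n <= h1 + h2 + (s1 + e1) by lia.
have l2 : n <= h1 + h2 + (s2 + e2) by lia.
clear -l1 l2 t1E t2E; rewrite /V1 /V2 /delta; lia.
Qed.

Let delta_ge : s1 <= a n + d1 -> s2 <= b n + d2 -> s1 + s2 <= delta + tau n.
Proof.
by have := tau_a (leqnn n); have := tau_b (leqnn n); rewrite /delta; lia.
Qed.

(** Only M2 is reached, first at index j. Before j the degree [tau] stays above t2 - h2, which
    bounds j; from j on it starts at no more than t1 + s2. *)
Lemma numbers_second j : j <= n -> t1 <= a n + h1 -> s2 <= b n + d2 -> b j <= s2 ->
  (0 < j -> t2 < b j.-1 + h2) -> n <= V2.
Proof.
move=> jn ha hb hj hp.
have tj : tau j <= t1 + s2 by have := tau_ab jn; have := a_le jn; lia.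
have tnj : n + tau n <= tau j + j.
  by have := tau_drop (i := j) (j := n); rewrite jn leqnn => /(_ isT); lia.
have hj' : j <= t1 + h2.
  case: (posnP j) => [->//|j0]; have hj1 : j.-1 <= n by lia.
  by have := hp j0; have := tau_b hj1; have := @tau_pred j; rewrite j0 jn => /(_ isT); lia.
have hbn := tau_b (leqnn n); have han := tau_a (leqnn n).
have l1 : n + tau n <= h2 + e2 + t1 + s2 by lia.
have l2 : n + tau n <= h2 + t1 + t1 + s2 by lia.
have l3 : t1 <= tau n + h1 by lia.
have l4 : s2 <= tau n + d2 by lia.
have l5 : n + tau n <= h2 + minn t1 e2 + (t1 + s2) by lia.
have l6 : minn (h1 + s2) (t1 + d2) <= h1 + minn s2 e1 + delta.
  by clear -t1E; rewrite /delta; lia.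
by clear -l3 l4 l5 l6; rewrite /V2; lia.
Qed.

(** Both are reached, M2 at index j and M1 later at index i; the chain is measured on the three
    stretches cut out by j and i. *)
Lemma numbers_lt i j : i <= n -> j < i -> s1 <= a n + d1 -> s2 <= b n + d2 ->
  a i <= s1 -> b i <= s2 -> b j <= s2 ->
  t1 < a i.-1 + h1 -> (0 < j -> t2 < b j.-1 + h2) -> n <= V2.
Proof.
move=> ile ji ha hb ai bi bj hi1 hj1; have hd := delta_ge ha hb.
have jn : j <= n by lia.
have i1n : i.-1 <= n by lia.
have ti : tau i <= s1 + s2 by have := tau_ab ile; lia.
have tj : tau j <= t1 + s2 by have := tau_ab jn; have := a_le jn; lia.
have tni : n + tau n <= tau i + i.
  by have := tau_drop (i := i) (j := n); rewrite ile leqnn => /(_ isT); lia.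
have tnj : n + tau n <= tau j + j.
  by have := tau_drop (i := j) (j := n); rewrite jn leqnn => /(_ isT); lia.
have tij : i + tau i.-1 <= (tau j + j).+1.
  have ji1 : j <= i.-1 by lia.
  by have := tau_drop (i := j) (j := i.-1); rewrite ji1 i1n => /(_ isT); lia.
have ti1 : t1 < tau i.-1 + h1 by have := tau_a i1n; lia.
have ip : i + tau i.-1 <= (t1 + t2).+1 by apply: tau_pred; lia.
have hj' : j <= t1 + h2.
  case: (posnP j) => [->//|j0]; have j1n : j.-1 <= n by lia.
  by have := hj1 j0; have := tau_b j1n; have := @tau_pred j; rewrite j0 jn => /(_ isT); lia.
have l1 : n <= h1 + h2 + e1 + e2 + delta by lia.
have l2 : n <= h1 + h2 + s2 + e2 + delta by lia.
have l3 : n <= h1 + h2 + e1 + t1 + delta by lia.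
have l4 : n <= h1 + h2 + t1 + s2 + delta by lia.
by clear -l1 l2 l3 l4; rewrite /V2; move: delta l1 l2 l3 l4 => D; lia.
Qed.

(** Both are reached at the same index i, and either route may be the longer one. *)
Lemma numbers_eq i : i <= n -> s1 <= a n + d1 -> s2 <= b n + d2 ->
  a i <= s1 -> b i <= s2 ->
  (0 < i -> t1 < a i.-1 + h1) -> (0 < i -> t2 < b i.-1 + h2) -> n <= maxn V1 V2.
Proof.
move=> ile ha hb ai bi hi1 hi2; have hd := delta_ge ha hb.
have ti : tau i <= s1 + s2 by have := tau_ab ile; lia.
have tni : n + tau n <= tau i + i.
  by have := tau_drop (i := i) (j := n); rewrite ile leqnn => /(_ isT); lia.
have l1 : n <= h1 + h2 + e1 + e2 + delta by lia.
have [l2 l3] : i <= h1 + t2 /\ i <= t1 + h2.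
  case: (posnP i) => [->//|i0]; have i1n : i.-1 <= n by lia.
  have := tau_a i1n; have := tau_b i1n; have := hi1 i0; have := hi2 i0.
  have : i + tau i.-1 <= (t1 + t2).+1 by apply: tau_pred; lia.
  lia.
have l4 : n <= h1 + h2 + (s2 + e2) + delta by lia.
have l5 : n <= h1 + h2 + (s1 + e1) + delta by lia.
clear -l1 l4 l5 t1E t2E; rewrite /V1 /V2; move: delta l1 l4 l5 => D; lia.
Qed.

End ChainNumbers.

Section Upper.
Variables (A B C : comAlgType k) (j1 : {rmorphism A -> C}) (j2 : {rmorphism B -> C}).
Hypothesis hC : is_tensor j1 j2.
Variables (M1 : A -> Prop) (M2 : B -> Prop).
Variables (t1 h1 s1 d1 e1 t2 h2 s2 d2 e2 : nat).
Hypothesis pr1 : profile M1 t1 h1 s1 d1 e1.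
Hypothesis pr2 : profile M2 t2 h2 s2 d2 e2.

Lemma first_index (G : nat -> Prop) n : G n -> exists i, [/\ i <= n, G i & 0 < i -> ~ G i.-1].
Proof.
move=> Gn; have ex : exists i, `[< G i >] by exists n; apply/asboolP.
have [i /asboolP Gi imin] := ex_minnP ex.
exists i; split=> //; first by apply: imin; apply/asboolP.
by move=> i0 /asboolP /imin; lia.
Qed.

Let bound1 (P : A -> Prop) : is_prime P -> bounded_td (in_alg A) P t1.
Proof.
move=> hP; apply: bounded_td_sub (pr_bound pr1) => a ->.
by apply: ideal0; exact: prime_ideal.
Qed.
Let bound2 (P : B -> Prop) : is_prime P -> bounded_td (in_alg B) P t2.
Proof.
move=> hP; apply: bounded_td_sub (pr_bound pr2) => a ->.
by apply: ideal0; exact: prime_ideal.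
Qed.

Lemma tensor_bounded_td (P : C -> Prop) : is_prime P -> bounded_td (in_alg C) P (t1 + t2).
Proof.
move=> hP n x hx.
have hb1 := bound1 (prime_preim j1 hP); have hb2 := bound2 (prime_preim j2 hP).
apply: leq_trans (tensor_td_le hC hP hb1 hb2 hx) _; apply: leq_add.
  exact: gtd_le (prime_preim j1 hP) hb1.
exact: gtd_le (prime_preim j2 hP) hb2.
Qed.

Lemma tensor_dim_le : dim_le C (t1 + t2).
Proof.
move=> n P Q hc; have hP := chain_bot hc.
have := chain_td (tensor_bounded_td hP) hc.
have := gtd_le hP (tensor_bounded_td hP); lia.
Qed.

Lemma tensor_upper (c : nat -> C -> Prop) n : prime_chain c n ->
  n <= maxn (h1 + minn t2 e1 + (h2 + minn s1 e2 + minn (s1 + d2) (d1 + s2)))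
            (h2 + minn t1 e2 + (h1 + minn s2 e1 + minn (s1 + d2) (d1 + s2))).
Proof.
move=> [hp hs].
pose p i : A -> Prop := fun x => c i (j1 x); pose q i : B -> Prop := fun x => c i (j2 x).
pose a i := td_mod (p i); pose b i := td_mod (q i); pose tau i := td_mod (c i).
have pp i : i <= n -> is_prime (p i) by move=> hi; apply: prime_preim; exact: hp.
have qp i : i <= n -> is_prime (q i) by move=> hi; apply: prime_preim; exact: hp.
have mono i j : i <= j <= n -> forall x, c i x -> c j x.
  move=> /andP[ij jn]; rewrite -(subnKC ij) in jn *.
  elim: (j - i) jn => [|l IH] jn x hx; first by rewrite addn0.
  rewrite addnS; apply: (proj1 (hs (i + l) _)); first lia.
  by apply: IH => //; lia.
have drop1 i : i < n -> tau i.+1 + 1 <= tau i.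
  move=> hi; rewrite addn1; apply: (gtd_drop (hp _ (ltnW hi)) (hp _ hi)).
  - exact: (proj1 (hs _ hi)).
  - exact: (proj2 (hs _ hi)).
  - by apply: tensor_bounded_td; apply: hp; exact: ltnW.
have tau_drop i j : i <= j <= n -> tau j + (j - i) <= tau i.
  move=> /andP[ij jn]; rewrite -{1 2}(subnKC ij) in jn *.
  elim: (j - i) jn => [|l IH] jn; first by rewrite !addn0.
  have h1' : i + l < n by lia.
  by have := drop1 _ h1'; have := IH (ltnW h1'); rewrite !addnS; lia.
have tau_a i : i <= n -> a i <= tau i.
  move=> hi; apply: gtd_le (pp i hi) _.
  apply: td_mod_comp_le (tensor_scalar1 hC) (hp i hi) (tensor_bounded_td (hp i hi)).
have tau_b i : i <= n -> b i <= tau i.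
  move=> hi; apply: gtd_le (qp i hi) _.
  apply: td_mod_comp_le (tensor_scalar2 hC) (hp i hi) (tensor_bounded_td (hp i hi)).
have tau_ab i : i <= n -> tau i <= a i + b i.
  move=> hi; have h := tensor_td_le hC (hp i hi) (bound1 (pp i hi)) (bound2 (qp i hi)).
  exact: gtd_le (hp i hi) h.
have a_le i : i <= n -> a i <= t1 by move=> hi; exact: gtd_le (pp i hi) (bound1 (pp i hi)).
have b_le i : i <= n -> b i <= t2 by move=> hi; exact: gtd_le (qp i hi) (bound2 (qp i hi)).
have t1E := pr_sum pr1; have t2E := pr_sum pr2.
have tau_ba i : i <= n -> tau i <= b i + a i by rewrite addnC; exact: tau_ab.
have up1 i j : i <= j <= n -> contains M1 (p i) -> contains M1 (p j).
  by move=> hij h x /h; exact: mono.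
have up2 i j : i <= j <= n -> contains M2 (q i) -> contains M2 (q j).
  by move=> hij h x /h; exact: mono.
have below1 i : i <= n -> contains M1 (p n) -> ~ contains M1 (p i) -> t1 < a i + h1.
  move=> hi hn ni; apply: (pr_below pr1 (pp i hi) (pp n (leqnn n))) => // x.
  by apply: mono; rewrite hi leqnn.
have below2 i : i <= n -> contains M2 (q n) -> ~ contains M2 (q i) -> t2 < b i + h2.
  move=> hi hn ni; apply: (pr_below pr2 (qp i hi) (qp n (leqnn n))) => // x.
  by apply: mono; rewrite hi leqnn.
have above1 i : i <= n -> contains M1 (p i) -> a i <= s1 <= a i + d1.
  by move=> hi; apply: (pr_above pr1); exact: pp.
have above2 i : i <= n -> contains M2 (q i) -> b i <= s2 <= b i + d2.
  by move=> hi; apply: (pr_above pr2); exact: qp.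
have dE : minn (s2 + d1) (d2 + s1) = minn (s1 + d2) (d1 + s2) by lia.
case: (pselect (contains M1 (p n))) => [c1|n1]; case: (pselect (contains M2 (q n))) => [c2|n2].
- have [i [ile ci pi]] := first_index (G := fun i => contains M1 (p i)) c1.
  have [j [jle cj pj]] := first_index (G := fun i => contains M2 (q i)) c2.
  have /andP[ai _] := above1 _ ile ci; have /andP[bj _] := above2 _ jle cj.
  have /andP[_ an] := above1 _ (leqnn n) c1; have /andP[_ bn] := above2 _ (leqnn n) c2.
  have hi1 : 0 < i -> t1 < a i.-1 + h1 by move=> i0; apply: below1 => //; [lia|exact: pi].
  have hj1 : 0 < j -> t2 < b j.-1 + h2 by move=> j0; apply: below2 => //; [lia|exact: pj].
  case: (ltngtP i j) => [ij|ji|eij].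
  (* M1 is reached first: the same count with the factors exchanged. *)
  + rewrite leq_max; apply/orP; left; rewrite -dE.
    have /andP[aj _] := above1 _ jle (up1 _ _ (introT andP (conj (ltnW ij) jle)) ci).
    apply: (numbers_lt tau_drop tau_b tau_a tau_ba t2E t1E b_le a_le jle ij) => //.
    by apply: hj1; lia.
  + rewrite leq_max; apply/orP; right.
    have /andP[bi _] := above2 _ ile (up2 _ _ (introT andP (conj (ltnW ji) ile)) cj).
    apply: (numbers_lt tau_drop tau_a tau_b tau_ab t1E t2E a_le b_le ile ji) => //.
    by apply: hi1; lia.
  + rewrite -eij in bj hj1.
    exact: (numbers_eq tau_drop tau_a tau_b tau_ab t1E t2E a_le b_le ile).
- have [i [ile ci pi]] := first_index (G := fun i => contains M1 (p i)) c1.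
  have /andP[ai _] := above1 _ ile ci; have /andP[_ an] := above1 _ (leqnn n) c1.
  have hi1 : 0 < i -> t1 < a i.-1 + h1 by move=> i0; apply: below1 => //; [lia|exact: pi].
  rewrite leq_max; apply/orP; left; rewrite -dE.
  apply: (numbers_second tau_drop tau_b tau_a tau_ba d2 t2E t1E b_le a_le ile) => //.
  exact: (pr_not pr2 (qp n (leqnn n)) n2).
- have [j [jle cj pj]] := first_index (G := fun i => contains M2 (q i)) c2.
  have /andP[bj _] := above2 _ jle cj; have /andP[_ bn] := above2 _ (leqnn n) c2.
  have hj1 : 0 < j -> t2 < b j.-1 + h2 by move=> j0; apply: below2 => //; [lia|exact: pj].
  rewrite leq_max; apply/orP; right.
  apply: (numbers_second tau_drop tau_a tau_b tau_ab d1 t1E t2E a_le b_le jle) => //.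
  exact: (pr_not pr1 (pp n (leqnn n)) n1).
- apply: (numbers_neither tau_drop tau_a tau_b tau_ab d1 d2 t1E t2E a_le b_le).
    exact: (pr_not pr1 (pp n (leqnn n)) n1).
  exact: (pr_not pr2 (qp n (leqnn n)) n2).
Qed.

End Upper.
End Profile.


(** * Chains in pullbacks *)

Section ChainMaps.
Local Open Scope ring_scope.

Lemma chain_cat (A : comNzRingType) n m (P Q S : A -> Prop) :
  chain n P Q -> chain m Q S -> chain (n + m) P S.
Proof.
move=> h hc; elim: hc h => [R _ h|{}m R S1 S2 _ IH hS2 sub ne h]; first by rewrite addn0.
by rewrite addnS; apply: chainS (IH h) hS2 sub ne.
Qed.

Lemma chain1 (A : comNzRingType) (P Q : A -> Prop) : is_prime P -> is_prime Q ->
  (forall x, P x -> Q x) -> (exists x, Q x /\ ~ P x) -> chain 1 P Q.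
Proof. by move=> hP; apply: chainS; exact: chain0. Qed.

Section SurjPreim.
Variables (A B : comNzRingType) (f : {rmorphism A -> B}).
Hypothesis f_surj : forall b, exists a, f a = b.

Lemma chain_preim n (P Q : B -> Prop) : chain n P Q ->
  chain n (fun a => P (f a)) (fun a => Q (f a)).
Proof.
elim=> [R hR|m R S S' _ IH hS' sub [b [hb nb]]]; first by apply: chain0; exact: prime_preim.
apply: chainS IH _ _ _; [exact: prime_preim|by move=> x; apply: sub|].
by have [a ea] := f_surj b; exists a; rewrite ea.
Qed.

Lemma prime_image (P : A -> Prop) : is_prime P -> (forall a, f a = 0 -> P a) ->
  exists Q, is_prime Q /\ P = fun a => Q (f a).
Proof.
move=> hP hk; have hI := prime_ideal hP.
pose Q b := exists a, f a = b /\ P a.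
have QE a : Q (f a) <-> P a.
  split=> [[a' [e Pa']]|Pa]; last by exists a.
  rewrite -(subrK a' a); apply: idealD => //; apply: hk.
  by rewrite rmorphB e subrr.
exists Q; split; last by apply: subset_eq => a /QE.
split; last split.
- split; first by rewrite -(rmorph0 f); apply/QE; exact: ideal0.
  split=> [x y|x y]; have [a <-] := f_surj x; have [b <-] := f_surj y.
    by rewrite -rmorphD => /QE ha /QE hb; apply/QE; exact: idealD.
  by rewrite -rmorphM => /QE hb; apply/QE; exact: ideal_mull.
- by rewrite -(rmorph1 f) => /QE; exact: prime1.
- move=> x y; have [a <-] := f_surj x; have [b <-] := f_surj y.
  by rewrite -rmorphM => /QE /(primeM hP)[] ?; [left|right]; apply/QE.
Qed.
End SurjPreim.

Lemma td_mod_surj (k : fieldType) (A B : comAlgType k) (f : {rmorphism A -> B}) (P : B -> Prop) :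
  (forall c : k, f c%:A = c%:A) -> (forall b, exists a, f a = b) ->
  td_mod (fun a => P (f a)) = td_mod P.
Proof.
move=> hf fs; apply: eq_natsup => n; split=> -[x hx].
  by exists (f \o x); apply/(gindep_comp _ _ hf).
exists (fun i => projT1 (cid (fs (x i)))); apply/(gindep_comp _ _ hf).
rewrite (_ : f \o _ = x) //; apply/funext => i /=.
by case: cid.
Qed.

Section LinkChain.
Variables (R T : comNzRingType) (io : {rmorphism R -> T}) (n : nat) (u : nat -> T).
Notation sp := (@specialize R T io n u).

Lemma ext_preim0 (p : T -> Prop) :
  (fun f => ext_ideal n p (sp 0 f)) = ext_ideal n (fun r => p (io r)).
Proof.
by apply: subset_eq => f h m; have := h m; rewrite specialize0 mcoeff_map_mpoly.
Qed.

(* Specializing one more variable adds 'X_l - u_l, cleared of its denominator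
   io r0, to the prime. *)
Lemma link_chain (p : T -> Prop) m : is_prime p -> (m <= n)%N ->
  (exists r0, ~ p (io r0) /\ forall l, (l < m)%N -> exists r1, io r1 = io r0 * u l) ->
  chain m (fun f => ext_ideal n p (sp 0 f)) (fun f => ext_ideal n p (sp m f)).
Proof.
move=> hp; have hE := ext_prime n hp; elim: m => [|m IH] mn [r0 [nr0 hr]].
  by apply: chain0; exact: (prime_preim (@specialize R T io n u 0)).
apply: chainS (IH (ltnW mn) _) _ _ _.
- by exists r0; split=> // l lm; apply: hr; rewrite ltnS ltnW.
- exact: (prime_preim (@specialize R T io n u m.+1)).
- move=> f; rewrite (specializeS _ _ mn); apply: mmap_ideal; first exact: prime_ideal.
  by move=> a pa; apply/ext_ideal_mpolyC => //; exact: prime_ideal.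
have [r1 er1] := hr m (ltnSn m); exists (r0%:MP * 'X_(Ordinal mn) - r1%:MP).
rewrite !rmorphB !rmorphM /= !specializeC !specializeX /= ltnSn ltnn; split.
  by rewrite -mpolyCM er1 subrr; apply: ideal0; exact: prime_ideal.
move=> /(_ U_(Ordinal mn)%MM); rewrite mcoeffB mcoeffCM mcoeffX eqxx mulr1 mcoeffC.
by rewrite mnm1_eq0 mulr0 subr0.
Qed.

(** Distinct primes of T can contract to the same prime of R. Here [w] multiplies T into R and
    avoids the whole chain, so [w] times a separating element still separates. *)
Lemma contract_chain m l (P Q : T -> Prop) w : chain l P Q -> ~ Q w ->
  (forall t, exists r, io r = w * t) ->
  chain l (fun f => ext_ideal n P (sp m f)) (fun f => ext_ideal n Q (sp m f)).
Proof.
move=> hc + hw; elim: hc => [S hS _|{}l S S1 S2 hc IH hS2 sub [x [hx nx]] nw].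
  by apply: chain0; apply: (prime_preim (@specialize R T io n u m)); exact: ext_prime.
have nw1 : ~ S1 w by move/sub.
apply: chainS (IH nw1) _ _ _.
- by apply: (prime_preim (@specialize R T io n u m)); exact: ext_prime.
- by move=> f; apply: ext_ideal_mono.
have [r er] := hw x; exists r%:MP; rewrite specializeC er.
have hS1 := chain_top hc.
split; first by apply/ext_ideal_mpolyC; [exact: prime_ideal|apply: ideal_mull => //; exact: prime_ideal].
move/ext_ideal_mpolyC => /(_ (prime_ideal hS1)) /(primeM hS1)[]//.
Qed.

End LinkChain.
End ChainMaps.


(** * Profiles of pullbacks of AF-domains *)

Section PullbackProfile.
Local Open Scope ring_scope.
Variables (k : fieldType) (T K D R : comAlgType k).
Variables (M : T -> Prop) (phi : {rmorphism T -> K}) (iD : {rmorphism D -> K})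
  (iR : {rmorphism R -> T}).
Hypotheses (phi_k : forall c : k, phi c%:A = c%:A) (iD_k : forall c : k, iD c%:A = c%:A)
  (iR_k : forall c : k, iR c%:A = c%:A).
Hypotheses (domT : is_domain T) (maxM : is_maximal M)
  (phi_surj : forall y, exists t, phi t = y) (phi_ker : forall t, phi t = 0 <-> M t)
  (iD_inj : injective iD) (iR_inj : injective iR)
  (iR_img : forall t, (exists r, iR r = t) <-> (exists d, iD d = phi t)).
Hypotheses (afT : AF_domain T) (afD : AF_domain D) (dimT : kdim T = height M).

Notation MR := (fun r => M (iR r)).
Let M_prime := maximal_prime maxM.
Let M_ideal := prime_ideal M_prime.

Lemma residue_hom : exists psi : {rmorphism R -> D}, [/\ forall c : k, psi c%:A = c%:A,
  forall r, iD (psi r) = phi (iR r), forall d, exists r, psi r = d &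
  forall r, psi r = 0 <-> M (iR r)].
Proof.
have ex r : exists d, iD d = phi (iR r) by apply/iR_img; exists r.
pose f r := projT1 (cid (ex r)).
have fE r : iD (f r) = phi (iR r) by rewrite /f; case: cid.
have hf : kalg_hom f.
  split; first by move=> x y; apply: iD_inj; rewrite rmorphD !fE !rmorphD.
  split; first by move=> x y; apply: iD_inj; rewrite rmorphM !fE !rmorphM.
  split; first by apply: iD_inj; rewrite fE !rmorph1.
  move=> c x; apply: iD_inj; rewrite fE -[c *: x]mul1r -[c *: f x]mul1r.
  by rewrite -!scalerAr !scalerAl !rmorphM fE iR_k phi_k iD_k.
have [psi [psiE psi_k]] := kalg_homE hf.
have e r : iD (psi r) = phi (iR r) by rewrite psiE.
exists psi; split=> // [d|r].
  have [t et] := phi_surj (iD d).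
  have [r er] : exists r, iR r = t by apply/iR_img; exists d.
  by exists r; apply: iD_inj; rewrite e er.
rewrite -phi_ker -e; split=> [->|h]; first by rewrite rmorph0.
by apply: iD_inj; rewrite h rmorph0.
Qed.

Lemma M_lift t : M t -> exists r, iR r = t.
Proof. by move=> /phi_ker h; apply/iR_img; exists 0; rewrite h rmorph0. Qed.

Lemma boundT : exists b, bounded_td (in_alg T) (fun a => a = 0) b.
Proof. by have [_ [[b hb] _]] := afT; exists b. Qed.
Lemma boundD : exists b, bounded_td (in_alg D) (fun a => a = 0) b.
Proof. by have [_ [[b hb] _]] := afD; exists b. Qed.

Lemma domR : is_domain R.
Proof.
move=> x y /(congr1 iR); rewrite rmorphM rmorph0 => /domT[]; rewrite -(rmorph0 iR) => /iR_inj ->.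
  by left.
by right.
Qed.

Lemma iR0 : (fun r => iR r = 0) = (fun r => r = 0).
Proof.
by apply: subset_eq => r; [rewrite -(rmorph0 iR) => /iR_inj|move->; rewrite rmorph0].
Qed.

Lemma tdR_le : bounded_td (in_alg R) (fun a => a = 0) (td T).
Proof.
have [b hb] := boundT; rewrite -iR0.
exact: td_mod_comp_le iR_k (zero_prime domT) hb.
Qed.

Lemma boundR : bounded_td (in_alg R) (fun a => a = 0) (td R).
Proof. by have [_] := gtdP (zero_prime domR) tdR_le. Qed.

Lemma tdR_tdT : (td R <= td T)%N.
Proof. exact: gtd_le (zero_prime domR) tdR_le. Qed.

Lemma bound_prime (A : comAlgType k) b (P : A -> Prop) : is_prime P ->
  bounded_td (in_alg A) (fun a => a = 0) b -> bounded_td (in_alg A) P b.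
Proof. by move=> hP; apply: bounded_td_sub => a ->; apply: ideal0; exact: prime_ideal. Qed.

Lemma dim_leT : exists b, dim_le T b.
Proof. by have [b hb] := boundT; exists b; exact: dim_le_td hb. Qed.
Lemma dim_leD : exists b, dim_le D b.
Proof. by have [b hb] := boundD; exists b; exact: dim_le_td hb. Qed.

(* A prime p of R not containing M is the contraction of the prime
   (p : m0) of T for any m0 in M outside p, with the same fraction field. *)
Lemma prime_outside (p : R -> Prop) : is_prime p -> ~ contains MR p ->
  exists Q, [/\ is_prime Q, forall r, Q (iR r) <-> p r & (td_mod Q <= td_mod p)%N].
Proof.
move=> hp /not_subset[m0 [Mm0 nm0]]; have hpI := prime_ideal hp.
have ex t : exists r, iR r = iR m0 * t by apply: M_lift; exact: ideal_mulr.
pose Q t := exists r, iR r = iR m0 * t /\ p r.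
have QE r : Q (iR r) <-> p r.
  split=> [[r' [e pr']]|pr]; last by exists (m0 * r); rewrite rmorphM; split=> //; exact: ideal_mull.
  by move: e; rewrite -rmorphM => /iR_inj e; move: pr'; rewrite e => /(primeM hp)[].
have hQ : is_prime Q.
  split; last split.
  - split; first by exists 0; rewrite rmorph0 mulr0; split=> //; exact: ideal0.
    split=> [x y [r [er pr]] [r' [er' pr']]|a x [r [er pr]]].
      by exists (r + r'); rewrite rmorphD er er' mulrDr; split=> //; exact: idealD.
    have [ra era] := ex a; have [rx erx] := ex (a * x); exists rx; split=> //.
    have : p (m0 * rx).
      have -> : m0 * rx = ra * r by apply: iR_inj; rewrite !rmorphM era er erx; ring.
      exact: ideal_mull.
    by case/(primeM hp).
  - by move=> [r [er pr]]; apply: nm0; move: er; rewrite mulr1 => /iR_inj <-.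
  - move=> x y [r [er pr]]; have [rx erx] := ex x; have [ry ery] := ex y.
    have : p (rx * ry).
      have -> : rx * ry = m0 * r by apply: iR_inj; rewrite !rmorphM er erx ery; ring.
      exact: ideal_mull.
    by case/(primeM hp) => h; [left|right]; [exists rx|exists ry].
exists Q; split=> //; have [F [pi hpi]] := residue_field hQ.
have hpiR r : (pi \o iR) r = 0 <-> p r by rewrite /= hpi.
have [x [_ hx]] := gtd_basis hp (bound_prime hp boundR).
have [b hb] := boundT.
suff h : bounded_td (in_alg T) Q (td_mod p) by exact: gtd_le hQ h.
pose s' := mkseq ((pi \o iR) \o x) (td_mod p).
have -> : td_mod p = size s' by rewrite size_mkseq.
apply: (gindep_bound hpi) => t; have [r er] := ex t.
have algR r' : alg (with_seq (img (pi \o in_alg T)) s') (pi (iR r')).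
  apply: alg_mono (hx _ (pi \o iR) hpiR r') => z [[c ->]|zs]; last by right.
  by left; exists c; rewrite /= iR_k.
have pm0 : pi (iR m0) != 0 by apply/eqP => /hpiR.
have -> : pi t = pi (iR r) / pi (iR m0) by rewrite er rmorphM mulrAC mulfV ?mul1r.
have /algP h1 := algR r; have /algP h2 := algR m0.
by apply/algP; exact: algebraic_div.
Qed.

Lemma above_prime (p : R -> Prop) : is_prime p -> contains MR p ->
  (td_mod p <= td D <= td_mod p + kdim D)%N.
Proof.
move=> hp sub; have [psi [psi_k _ psi_surj psi_ker]] := residue_hom.
have [|q [hq ->]] := prime_image psi_surj hp; first by move=> r /psi_ker /sub.
rewrite td_mod_surj //; have [_ [_ /(_ _ hq) <-]] := afD.
have [b hb] := dim_leD; have := height_le_kdim hb hq; lia.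
Qed.

Lemma td_MR : td_mod MR = td D.
Proof.
have [psi [psi_k _ psi_surj psi_ker]] := residue_hom.
have -> : MR = (fun r => psi r = 0) by apply: subset_eq => r /psi_ker.
exact: (td_mod_surj (fun d => d = 0)).
Qed.

Lemma prime_MR : is_prime MR. Proof. exact: prime_preim. Qed.

(** The assumption dim T = ht M enters here: the prime of T over p has height at most ht M, and the
    AF-domain formula turns this into a lower bound for the degree of R/p. *)
Lemma td_not (p : R -> Prop) : is_prime p -> ~ contains MR p ->
  (td R <= td_mod p + height M)%N.
Proof.
move=> hp np; have [Q [hQ _ tdQ]] := prime_outside hp np.
have := tdR_tdT; have [_ [_ /(_ _ hQ) <-]] := afT.
have [b hb] := dim_leT; have := height_le_kdim hb hQ; rewrite dimT; lia.
Qed.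

(** The prime Q of T over p lies in M, strictly: for t in Q outside M, write 1 = u + v t with u in
    M; then 1 - u is in p, so both 1 - u and u are in p'. Hence ht Q < ht M. *)
Lemma td_below (p p' : R -> Prop) : is_prime p -> is_prime p' -> contains p p' ->
  contains MR p' -> ~ contains MR p -> (td R < td_mod p + height M)%N.
Proof.
move=> hp hp' pp' Mp' np; have [Q [hQ QE tdQ]] := prime_outside hp np.
have QM t : Q t -> M t.
  move=> Qt; apply: contrapT => nMt.
  have [_ [_ /(_ _ (ideal_adjoin_ideal t M_ideal))]] := maxM.
  case=> [x Mx|h|[u [v [Mu e1]]]].
  - exact: ideal_adjoin_sub.
  - by apply: nMt; apply: h; exact: ideal_adjoin_mem.
  have [r er] := M_lift Mu.
  have : p (1 - r).
    apply/QE; have -> : iR (1 - r) = v * t by rewrite rmorphB rmorph1 er e1; ring.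
    by apply: ideal_mull => //; exact: prime_ideal.
  move/pp' => h; apply: (prime1 hp'); rewrite -[1](subrK r).
  by apply: idealD; [exact: prime_ideal|exact: h|apply: Mp'; rewrite er].
have [b hb] := dim_leT.
have lt : (height Q < height M)%N.
  apply: height_lt hb hQ M_prime QM _.
  by have /not_subset[m0 [Mm0 nm0]] := np; exists (iR m0); split=> // /QE.
have := tdR_tdT; have [_ [_ /(_ _ hQ) <-]] := afT; lia.
Qed.

Lemma top_chain : exists m : R -> Prop, chain (kdim D) MR m /\ (td_mod m + kdim D = td D)%N.
Proof.
have [psi [psi_k _ psi_surj psi_ker]] := residue_hom.
have [b hb] := dim_leD; have [domD [_ hAF]] := afD; have h0 := zero_prime domD.
have [q0 [q1 hc]] := kdim_attained hb h0.
(* A longest chain of D is made to start at 0, so that its top has height dim D. *)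
have [|E [hE _]] := chain_glue (chain0 h0) _ hc.
  by move=> x ->; apply: ideal0; apply: prime_ideal; exact: chain_bot hc.
have hEp := chain_top hE.
exists (fun r => E (psi r)); split.
  have -> : MR = (fun r => psi r = 0) by apply: subset_eq => r /psi_ker.
  exact: (chain_preim psi_surj hE).
rewrite td_mod_surj // -(hAF _ hEp).
have := height_ge hb hE; have := height_le_kdim hb hEp; rewrite add0n; lia.
Qed.

Section NonzeroM.
Variable w : T.
Hypotheses (Mw : M w) (w0 : w <> 0).

(** A nonzero element of M gives T and R the same fraction field. If M = 0 this can fail: R is then
    D, and T a field possibly transcendental over it. *)
Lemma td_TR : td T = td R.
Proof.
have h0 := zero_prime domR; have [rw erw] := M_lift Mw.
have [|Q [hQ QE tdQ]] := prime_outside h0.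
  move=> h; apply: w0; rewrite -erw (h rw) ?rmorph0 //.
  by rewrite erw.
have eQ : Q = fun t => t = 0.
  apply: subset_eq => t; last by move->; apply: ideal0; exact: prime_ideal.
  move=> Qt; have [r er] : exists r, iR r = w * t by apply: M_lift; exact: ideal_mulr.
  have : r = 0 by apply/QE; rewrite er; apply: ideal_mull => //; exact: prime_ideal.
  by move=> r0; move: er; rewrite r0 rmorph0 => /esym /domT[].
by apply/eqP; rewrite eqn_leq tdR_tdT andbT; move: tdQ; rewrite eQ.
Qed.

Lemma td_M : (height M + td_mod M = td R)%N.
Proof. by rewrite -td_TR; have [_ [_ ->]] := afT. Qed.

Lemma tdD_le : (td D <= td_mod M)%N.
Proof.
have [b hb] := boundT; have hbM := bound_prime M_prime hb.
rewrite -td_MR; apply: gtd_le prime_MR _.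
exact: td_mod_comp_le iR_k M_prime hbM.
Qed.

(** If no further element could be added, a basis of R/M together with u would bound the degree of
    T/M by td D + m - 1 at the failing stage. *)
Lemma free_lift (F : fieldType) (pi : {rmorphism T -> F}) m :
  (forall t, pi t = 0 <-> M t) -> (m + td D <= td_mod M)%N ->
  exists u : nat -> T, free_seq (img (pi \o iR)) (pi \o u) m.
Proof.
move=> hpi; elim: m => [|m IH] hm; first by exists (fun=> 0).
have [u hu] := IH (ltnW hm).
have [t nt] : exists t, ~ alg (before (img (pi \o iR)) (pi \o u) m) (pi t).
  apply: contrapT => hn; have {hn} hall t : alg (before (img (pi \o iR)) (pi \o u) m) (pi t).
    by apply: contrapT => h; apply: hn; exists t.
  have hpiR r : (pi \o iR) r = 0 <-> MR r by rewrite /= hpi.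
  have [x [_ hx]] := gtd_basis prime_MR (bound_prime prime_MR boundR).
  pose s := mkseq ((pi \o iR) \o x) (td_mod MR) ++ mkseq (pi \o u) m.
  have : bounded_td (in_alg T) M (size s).
    apply: (gindep_bound hpi) => t.
    apply: alg_trans (hall t) => z [[r ->]|[i im ->]].
      apply: alg_mono (hx _ (pi \o iR) hpiR r) => z' [[c ->]|zs].
        by left; exists c; rewrite /= iR_k.
      by right; rewrite mem_cat zs.
    apply: alg_base; right; rewrite mem_cat; apply/orP; right; apply/mapP.
    by exists i; rewrite ?mem_iota.
  move/(gtd_le M_prime); rewrite size_cat !size_mkseq => l.
  have {}l : (td_mod M <= td_mod MR + m)%N by exact: l.
  by rewrite td_MR in l; lia.
exists (fun i => if (i < m)%N then u i else t) => j; rewrite ltnS leq_eqVlt.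
case/orP => [/eqP ->|jm] /=.
  rewrite ltnn => h; apply: nt; apply: alg_mono h => z [Tz|[i im ->]]; first by left.
  by right; exists i; rewrite //= im.
rewrite jm => h; apply: (hu j jm); apply: alg_mono h => z [Tz|[i ij ->]]; first by left.
by right; exists i; rewrite //= (ltn_trans ij jm).
Qed.

(** Let p be the prime just below M in a longest chain of T. An element of M outside p multiplies T
    into R, so m links are made over the bottom prime, h - 1 steps climb to p with the variables
    specialized, and one last step reaches M[n]. *)
Lemma chain_to_ext n : exists P0,
  chain (height M + minn n (td_mod M - td D)) P0 (ext_ideal n MR).
Proof.
set m := minn _ _; have [b hb] := dim_leT.
have [F [pi hpi]] := residue_field M_prime.
have [u hu] : exists u : nat -> T, free_seq (img (pi \o iR)) (pi \o u) m.
  by apply: free_lift => //; have := tdD_le; rewrite /m; lia.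
have [p0 hc] := height_attained hb M_prime.
have hpos : (0 < height M)%N.
  apply: (height_ge hb (chain1 (zero_prime domT) M_prime _ _)).
    by move=> x ->; exact: ideal0.
  by exists w.
move: hc; rewrite -(prednK hpos); set h := (height M).-1 => hc.
inversion hc as [|h' P0' p' M' hp' hM sub [x [Mx nx]] e1 e2 e3]; subst P0' M' h'.
have np0 : ~ p0 x by move=> /(chain_sub hp').
have [rx erx] := M_lift Mx.
have hw t : exists r, iR r = x * t by apply: M_lift; exact: ideal_mulr.
have mn : (m <= n)%N by rewrite /m; lia.
have c1 : chain m (fun f => ext_ideal n p0 (specialize iR u 0 f))
                  (fun f => ext_ideal n p0 (specialize iR u m f)).
  apply: link_chain mn _; first exact: chain_bot hp'.
  by exists rx; rewrite erx; split.
have c2 := @contract_chain _ _ iR n u m _ _ _ _ hp' nx hw.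
have c3 := chain_cat c1 c2.
exists (fun f => ext_ideal n p0 (specialize iR u 0 f)); rewrite addSn addnC.
apply: chainS c3 _ _ _; first exact: (ext_prime n prime_MR).
  (* The kernel lies in M[n]: u is free over R modulo M, so f(u) in M forces the coefficients of f
     into M. *)
  move=> f hf mon; apply/hpi.
  apply: (@specialize_inj _ _ (pi \o iR) n (pi \o u) m f mn hu).
  have -> : specialize (pi \o iR) (pi \o u) m f = map_mpoly pi (specialize iR u m f).
    pose H : {rmorphism _ -> _} := map_mpoly pi \o @specialize R T iR n u m.
    apply: (@mpoly_hom_eq _ _ _ (specialize (pi \o iR) (pi \o u) m) H) => [c|i] /=.
      by rewrite !specializeC map_mpolyC.
    rewrite !specializeX; case: ifP => _; first by rewrite map_mpolyC.
    by rewrite map_mpolyX_id.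
  by apply/(ext_ideal_map _ hpi) => mon'; apply: sub; exact: hf.
exists rx%:MP; split.
  by apply/ext_ideal_mpolyC; [exact: prime_ideal prime_MR|rewrite erx].
rewrite specializeC erx => /ext_ideal_mpolyC h'; apply: nx; apply: h'.
by apply: prime_ideal; exact: chain_top hp'.
Qed.
End NonzeroM.

Lemma pullback_profile : exists e, profile MR (td R) (height M) (td D) (kdim D) e.
Proof.
case: (pselect (exists w, M w /\ w <> 0)) => [[w [Mw w0]]|hno].
  exists (td_mod M - td D)%N; split.
  - exact: domR.
  - exact: prime_MR.
  - by have := td_M Mw w0; have := tdD_le; lia.
  - exact: boundR.
  - exact: above_prime.
  - exact: td_not.
  - exact: td_below.
  - exact: chain_to_ext Mw w0.
  - exact: top_chain.
have M0 t : M t -> t = 0 by move=> Mt; apply: contrapT => t0; apply: hno; exists t.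
have hM0 : height M = 0%N.
  have [b hb] := dim_leT; have [p0 hc] := height_attained hb M_prime.
  inversion hc as [|h' P0' p' M' hp' hM sub [x [Mx nx]] e1 e2 e3] => //.
  case: nx; rewrite (M0 _ Mx); apply: ideal0; apply: prime_ideal; exact: chain_top hp'.
have eMR : MR = fun r => r = 0.
  rewrite -iR0; apply: subset_eq => r; first exact: M0.
  by move->; exact: ideal0.
have tdRD : td R = td D by rewrite -td_MR eMR.
(* For M = 0 the extended ideal M[n] is zero and has no chain below it, so e is 0 whatever the
   degree of T over D. *)
exists 0%N; split.
- exact: domR.
- exact: prime_MR.
- by rewrite hM0 tdRD addn0.
- exact: boundR.
- exact: above_prime.
- exact: td_not.
- exact: td_below.
- move=> n; exists (ext_ideal n MR); rewrite hM0 minn0.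
  by apply: chain0; apply: ext_prime; exact: prime_MR.
- exact: top_chain.
Qed.

End PullbackProfile.


(** * The lower bound *)

Section LowerBound.
Local Open Scope ring_scope.
Variable k : fieldType.

Lemma ext_chain (A : comNzRingType) l n (P Q : A -> Prop) : chain n P Q ->
  chain n (ext_ideal l P) (ext_ideal l Q).
Proof.
elim=> [R hR|m R S S' hc IH hS' sub [x [hx nx]]]; first by apply: chain0; exact: ext_prime.
apply: chainS IH _ _ _; [exact: ext_prime|exact: ext_ideal_mono|].
exists x%:MP; split; first by apply/ext_ideal_mpolyC => //; exact: prime_ideal.
by move/ext_ideal_mpolyC => h; apply: nx; apply: h; apply: prime_ideal; exact: chain_top hc.
Qed.

Section Lift.
Variables (A B C : comAlgType k) (j1 : {rmorphism A -> C}) (j2 : {rmorphism B -> C}).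
Hypothesis hC : is_tensor j1 j2.
Variables (m : nat) (y : 'I_m -> B) (q : B -> Prop).
Hypotheses (hq : is_prime q) (hy : alg_indep_mod q y).
Notation theta := (theta j1 j2 y).

(** The hypothesis [pp_emb] of [going_down] is automatic for any [pp] sent into a prime over [q],
    hence it persists down a chain. *)
Lemma theta_scalars (P : C -> Prop) (pp : {mpoly A[m]} -> Prop) :
  (forall x, P (j2 x) <-> q x) -> (forall r, pp r -> P (theta r)) ->
  forall l : {mpoly k[m]}, pp (map_mpoly (in_alg A) l) -> l = 0.
Proof.
move=> Pq sub l /sub; rewrite theta_emb // => /Pq h.
by apply/eqP; apply: contrapT => /negP /hy; apply.
Qed.

Lemma lift_chain n pp0 ppn : chain n pp0 ppn -> forall P : C -> Prop, is_prime P ->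
  (forall x, P (j2 x) <-> q x) -> (forall r, ppn r -> P (theta r)) ->
  exists P0 P', [/\ chain n P0 P', forall c, P' c -> P c, forall r, P' (theta r) <-> ppn r,
    forall x, P0 (j2 x) <-> q x & forall r, P0 (theta r) <-> pp0 r].
Proof.
elim=> [R hR|{}n R S S' hc IH hS' sub ne] P hP Pq Psub.
  have [P' [hP' P'P P'q P'R]] := going_down hC hq hy hR (theta_scalars Pq Psub) hP Pq Psub.
  by exists P', P'; split=> //; exact: chain0.
have [P' [hP' P'P P'q P'S]] := going_down hC hq hy hS' (theta_scalars Pq Psub) hP Pq Psub.
have [|P0 [P1 [c01 P1P' P1S P0q P0R]]] := IH P' hP' P'q; first by move=> r /sub /P'S.
exists P0, P'; split=> //; apply: chainS c01 hP' P1P' _.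
have [r [hr nr]] := ne; exists (theta r); split; first exact/P'S.
by move/P1S.
Qed.
End Lift.

Section Fiber.
Variables (A B C : comAlgType k) (j1 : {rmorphism A -> C}) (j2 : {rmorphism B -> C}).
Hypothesis hC : is_tensor j1 j2.
Variables (M m1 : A -> Prop) (d a : nat).
Hypotheses (chain_m1 : chain d M m1) (bA : bounded_td (in_alg A) (fun x => x = 0) a).
Variables (q : B -> Prop) (b : nat).
Hypotheses (hq : is_prime q) (bB : bounded_td (in_alg B) (fun x => x = 0) b).

(* Start from a prime containing x_i (x) 1 - 1 (x) y_i for x independent mod m1
   and y independent mod q, and undo these links one at a time. *)
Lemma fiber_chain : exists P0 P' : C -> Prop,
  [/\ chain (d + minn (td_mod m1) (td_mod q)) P0 P',
      forall x, P0 (j1 x) <-> M x & forall x, P0 (j2 x) <-> q x].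
Proof.
have hm1 := chain_top chain_m1; have hM := chain_bot chain_m1.
have [[x hx] _] := gtdP hm1 (bound_prime hm1 bA).
have [[y hy] _] := gtdP hq (bound_prime hq bB).
set r := minn _ _.
have {}hx : gindep (in_alg A) m1 (fun i : 'I_r => x i).
  by apply: gindep_prefix hm1 _ hx; exact: geq_minl.
have {}hy : gindep (in_alg B) q (fun i : 'I_r => y i).
  by apply: gindep_prefix hq _ hy; exact: geq_minr.
pose sp := @specialize A A idfun r x.
have cl : chain r (fun f => ext_ideal r m1 (sp 0%N f)) (fun f => ext_ideal r m1 (sp r f)).
  apply: link_chain => //; exists 1; split=> [|l _]; first exact: prime1.
  by exists (x l); rewrite mul1r.
have c1 : chain (d + r) (ext_ideal r M) (fun f => ext_ideal r m1 (sp r f)).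
  by apply: chain_cat (ext_chain r chain_m1) _; rewrite ext_preim0 in cl.
have hpp := chain_top cl.
(* All variables are specialized to x, which is independent modulo m1. *)
have pp_emb (l : {mpoly k[r]}) : ext_ideal r m1 (sp r (map_mpoly (in_alg A) l)) -> l = 0.
  rewrite /sp specialize_all mmap_map => /ext_ideal_mpolyC h.
  by apply/eqP; apply: contrapT => /negP /hx; apply; apply: h; exact: prime_ideal.
have [P [hP Pq Ppp]] := lying_over hC hq hy hpp pp_emb.
have [P0 [P' [c P'P _ P0q P0M]]] := lift_chain hC hq hy c1 hP Pq Ppp.
exists P0, P'; split=> // z.
rewrite -(thetaC j1 j2 (fun i : 'I_r => y i)) P0M ext_ideal_mpolyC //.
exact: prime_ideal.
Qed.
End Fiber.

Section Base.
Variables (A B C : comAlgType k) (j1 : {rmorphism A -> C}) (j2 : {rmorphism B -> C}).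
Hypothesis hC : is_tensor j1 j2.
Variables (p : A -> Prop) (q : B -> Prop) (b : nat).
Hypotheses (domA : is_domain A) (hq : is_prime q).
Hypothesis bB : bounded_td (in_alg B) (fun x => x = 0) b.

(** A prime over p and q contains the image of p[z], so a chain below p[z] lifts below it while the
    contraction to B stays q. Restarting that chain at 0 brings the contraction to A down to 0. *)
Lemma base_chain n pp0 (P : C -> Prop) : is_prime P ->
  (forall x, P (j1 x) <-> p x) -> (forall x, P (j2 x) <-> q x) ->
  chain n pp0 (ext_ideal (td_mod q) p) ->
  exists P0 P', [/\ chain n P0 P', forall c, P' c -> P c,
    forall x, P0 (j1 x) <-> x = 0 & forall x, P0 (j2 x) <-> q x].
Proof.
move=> hP Pp Pq hc; have hZ := ext_prime (td_mod q) (zero_prime domA).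
have [[y hy] _] := gtdP hq (bound_prime hq bB).
have {}hy : gindep (in_alg B) q (fun i : 'I_(td_mod q) => y i) by exact: hy.
have [|E [cE Ep]] := chain_glue (chain0 hZ) _ hc.
  move=> f hf; have -> : f = 0 by apply/mpolyP => m; rewrite mcoeff0; exact: hf.
  by apply: ideal0; exact: prime_ideal (chain_bot hc).
have [|P0 [P' [c P'P _ P0q P0Z]]] := lift_chain hC hq hy cE hP Pq.
  move=> r /Ep hr; apply: mmap_ideal hr; first exact: prime_ideal.
  by move=> x /Pp.
exists P0, P'; split=> // x.
rewrite -(thetaC j1 j2 (fun i : 'I_(td_mod q) => y i)) P0Z ext_ideal_mpolyC //.
exact/prime_ideal/zero_prime.
Qed.
End Base.

End LowerBound.

(** * Gluing the chains and comparing the two bounds *)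

Section Assembly.
Variable k : fieldType.
Variables (A B C : comAlgType k) (j1 : {rmorphism A -> C}) (j2 : {rmorphism B -> C}).
Hypothesis hC : is_tensor j1 j2.
Variables (M1 : A -> Prop) (M2 : B -> Prop).
Variables (h1 s1 d1 e1 h2 s2 d2 e2 : nat).
Hypothesis pr1 : profile M1 (td A) h1 s1 d1 e1.
Hypothesis pr2 : profile M2 (td B) h2 s2 d2 e2.

Lemma profile_td_M : td_mod M1 = s1.
Proof.
have [m [hc e]] := pr_top pr1; have hM := pr_prime pr1.
have /andP[le _] := pr_above pr1 hM (fun x h => h).
apply/eqP; rewrite eqn_leq le -e.
exact: chain_td (bound_prime hM (pr_bound pr1)) hc.
Qed.

Lemma ext_dim_le n : dim_le {mpoly B[n]} (td B + n).
Proof. exact: dim_le_td (mpoly_bounded_td (pr_dom pr2) (pr_bound pr2)). Qed.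

Lemma Dfun_attained s d :
  (exists q : B -> Prop, is_prime q /\
     Dfun s d B = height (ext_ideal s q) + minn s (d + td_mod q)) /\
  forall q : B -> Prop, is_prime q ->
     height (ext_ideal s q) + minn s (d + td_mod q) <= Dfun s d B.
Proof.
have [||h h'] := @natsupP (fun v => exists P : B -> Prop, is_prime P /\
  v = height (ext_ideal s P) + minn s (d + td_mod P)) (td B + s + s).
- by exists (height (ext_ideal s M2) + minn s (d + td_mod M2)), M2; split=> //; exact: pr_prime pr2.
- move=> v [P [hP ->]]; have hE := ext_prime s hP.
  have [P0 hc] := height_attained (ext_dim_le (n := s)) hE.
  exact: leq_add (ext_dim_le hc) (geq_minl _ _).
by split=> // q hq; apply: h'; exists q.
Qed.

(** The bottoms of the three glued pieces contract, going down, to the pairs (M1, q), (M1, 0) and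
    (0, 0). *)
Lemma lower_bound : height (ext_ideal (td B) M1) + Dfun s1 d1 B <= kdim C.
Proof.
have [[q [hq ->]] _] := Dfun_attained s1 d1.
have [m1 [cm1 tdm1]] := pr_top pr1; have hM1 := pr_prime pr1.
have bA := pr_bound pr1; have bB := pr_bound pr2.
have dA := mpoly_bounded_td (n := td B) (pr_dom pr1) bA.
have [ppA cA] := height_attained (dim_le_td dA) (ext_prime (td B) hM1).
have [ppB cB] := height_attained (ext_dim_le (n := td_mod M1)) (ext_prime (td_mod M1) hq).
have [P0 [P0' [c0 P0M P0q]]] := fiber_chain hC cm1 bA hq bB.
have [P1 [P1' [c1 P1'P0 P1z P1M]]] :=
  base_chain (tensor_sym hC) (pr_dom pr2) hM1 bA (chain_bot c0) P0q P0M cB.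
have [P2 [P2' [c2 P2'P1 _ _]]] :=
  base_chain hC (pr_dom pr1) (zero_prime (pr_dom pr2)) bB (chain_bot c1) P1M P1z cA.
have [E [cE _]] := chain_glue c1 P1'P0 c0.
have [E' [cE' _]] := chain_glue c2 P2'P1 cE.
apply: leq_trans (kdim_ge (tensor_dim_le hC pr1 pr2) cE').
have eH : height (ext_ideal (td_mod M1) q) = height (ext_ideal s1 q) by rewrite profile_td_M.
(* Since td_mod m1 + d1 = s1, d1 + min(td_mod m1, td_mod q) = min(s1, d1 + td_mod q). *)
by rewrite leq_add2l eH leq_add2l; lia.
Qed.

(** Test [Dfun] at the top m2 of the chain above M2: its extension has height at least h2 + min(s1,
    e2) + d2, and its residue degree is s2 - d2. *)
Lemma summand_ge :
  h1 + minn (td B) e1 + (h2 + minn s1 e2 + minn (s1 + d2) (d1 + s2)) <=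
  height (ext_ideal (td B) M1) + Dfun s1 d1 B.
Proof.
have dA := mpoly_bounded_td (n := td B) (pr_dom pr1) (pr_bound pr1).
have [P0 c0] := pr_chain pr1 (td B).
have [Q0 c1] := pr_chain pr2 s1; have [m2 [cm2 tdm2]] := pr_top pr2.
have l1 := height_ge (dim_le_td dA) c0.
have l2 := height_ge (ext_dim_le (n := s1)) (chain_cat c1 (ext_chain s1 cm2)).
have [_ /(_ _ (chain_top cm2)) l3] := Dfun_attained s1 d1.
apply: leq_add l1 _; apply: leq_trans l3; move: (height _) l2 => H; lia.
Qed.

End Assembly.

Lemma dim_tensor_profile (k : fieldType) (A B C : comAlgType k)
    (j1 : {rmorphism A -> C}) (j2 : {rmorphism B -> C})
    (M1 : A -> Prop) (M2 : B -> Prop) (h1 s1 d1 e1 h2 s2 d2 e2 : nat) :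
  is_tensor j1 j2 -> profile M1 (td A) h1 s1 d1 e1 -> profile M2 (td B) h2 s2 d2 e2 ->
  kdim C = maxn (height (ext_ideal (td B) M1) + Dfun s1 d1 B)
                (height (ext_ideal (td A) M2) + Dfun s2 d2 A).
Proof.
move=> hC pr1 pr2; have hC' := tensor_sym hC.
apply/eqP; rewrite eqn_leq; apply/andP; split; last first.
  by rewrite geq_max (lower_bound hC pr1 pr2) (lower_bound hC' pr2 pr1).
(* [kdim] is attained only if C has a prime at all; [fiber_chain] provides one. *)
have [c [hc _]] : exists c : nat -> C -> Prop, prime_chain c (kdim C) /\ True.
  have [m1 [cm1 _]] := pr_top pr1; have hM2 := pr_prime pr2.
  have [P0 [P0' [c0 _ _]]] := fiber_chain hC cm1 (pr_bound pr1) hM2 (pr_bound pr2).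
  have [Q [Q' hc]] := kdim_attained (tensor_dim_le hC pr1 pr2) (chain_bot c0).
  by have [c [hc' _ _]] := prime_chain_of_chain hc; exists c.
apply: leq_trans (tensor_upper hC pr1 pr2 hc) _.
have l1 := summand_ge pr1 pr2; have l2 := summand_ge pr2 pr1.
rewrite geq_max !leq_max l1 /=; apply/orP; right.
by apply: leq_trans l2; rewrite (addnC s2) (addnC d2) (minnC (d1 + s2)).
Qed.

Lemma pullback_setup_profile (k : fieldType) (T K D R : comAlgType k) (M : T -> Prop)
    (phi : T -> K) (iD : D -> K) (iR : R -> T) :
  pullback_setup M phi iD iR -> AF_domain T -> AF_domain D -> kdim T = height M ->
  exists e, profile (ideal_in iR M) (td R) (height M) (td D) (kdim D) e.
Proof.
move=> [domT [maxM [hphi [surj [ker [hiD [injD [_ [hiR [injR img]]]]]]]]]] afT afD dimT.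
have [phi' [/funext ephi phi_k]] := kalg_homE hphi; subst phi.
have [iD' [/funext eD iD_k]] := kalg_homE hiD; subst iD.
have [iR' [/funext eR iR_k]] := kalg_homE hiR; subst iR.
exact: (pullback_profile phi_k iD_k iR_k domT maxM surj ker injD injR img afT afD dimT).
Qed.

Theorem theorem1p9 (k : fieldType)
  (T1 K1 D1 R1 : comAlgType k) (M1 : T1 -> Prop) (phi1 : T1 -> K1)
  (iD1 : D1 -> K1) (iR1 : R1 -> T1)
  (T2 K2 D2 R2 : comAlgType k) (M2 : T2 -> Prop) (phi2 : T2 -> K2)
  (iD2 : D2 -> K2) (iR2 : R2 -> T2)
  (C : comAlgType k) (j1 : R1 -> C) (j2 : R2 -> C) :
  pullback_setup M1 phi1 iD1 iR1 ->
  pullback_setup M2 phi2 iD2 iR2 ->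
  AF_domain T1 -> AF_domain T2 -> AF_domain D1 -> AF_domain D2 ->
  kdim T1 = height M1 -> kdim T2 = height M2 ->
  is_tensor j1 j2 ->
  kdim C =
    maxn (height (ext_ideal (td R2) (ideal_in iR1 M1)) + Dfun (td D1) (kdim D1) R2)
         (height (ext_ideal (td R1) (ideal_in iR2 M2)) + Dfun (td D2) (kdim D2) R1).
Proof.
move=> ps1 ps2 afT1 afT2 afD1 afD2 dim1 dim2 hC.
have [e1 pr1] := pullback_setup_profile ps1 afT1 afD1 dim1.
have [e2 pr2] := pullback_setup_profile ps2 afT2 afD2 dim2.
have [hj1 [hj2 _]] := hC.
have [j1' [/funext ej1 _]] := kalg_homE hj1; subst j1.
have [j2' [/funext ej2 _]] := kalg_homE hj2; subst j2.
exact: (dim_tensor_profile hC pr1 pr2).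
Qed.
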